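(* Let $\kappa>0$ and $C>0$, let $\tau(x)=\exp(\mathrm{i}x^{1+1/\kappa})$ for $x>0$, and let $$\Omega=\Bigl\{s\in\mathbb{C}:\ \operatorname{Re}s\ge-\frac{C\log(|\operatorname{Im}s|+2)}{(1+|\operatorname{Im}s|)^\kappa}\Bigr\}.$$ Then $\tau\in L^\infty$, the Laplace transform $\mathcal{L}\{\tau;s\}=\int_0^\infty\tau(t)\mathrm{e}^{-st}\,\mathrm{d}t$ (defined for $\operatorname{Re}s>0$) admits an analytic continuation to $\Omega$, where it has at most polynomial growth, and, as $x\to\infty$, $$\int_0^x\tau(t)\,\mathrm{d}t=\mathcal{L}\{\tau;0\}+\frac{\exp\bigl(\mathrm{i}x^{1+1/\kappa}\bigr)}{\mathrm{i}(1+1/\kappa)x^{1/\kappa}}+O\bigl(x^{-1-2/\kappa}\bigr).$$ Consequently, the error term $O(x^{-1/\kappa})$ is optimal in the Tauberian statement: if $\tau\in L^\infty$ and $\mathcal{L}\{\tau;s\}$ admits an analytic continuation with at most polynomial growth to $\Omega$, then $\int_0^x\tau(t)\,\mathrm{d}t=\mathcal{L}\{\tau;0\}+O(x^{-1/\kappa})$.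
   Context: $\mathcal{L}\{\tau;0\}$ denotes the value at $s=0$ of the analytic continuation of the Laplace transform. ''At most polynomial growth'' in $\Omega$ means a bound $O\bigl((1+|s|)^{K}\bigr)$ for some $K$, for $s\in\Omega$. ''Optimal'' means that $O(x^{-1/\kappa})$ cannot be replaced by $o(x^{-1/\kappa})$ in the conclusion of that statement. *)

(* Defs.v *)
From HB Require Import structures.
From mathcomp Require Import all_boot all_order all_algebra.
From mathcomp Require Export complex.
From mathcomp Require Import all_classical all_reals all_analysis.
From mathcomp Require Import ess_sup_inf.
Set Implicit Arguments.
Unset Strict Implicit.
Unset Printing Implicit Defensive.
Import Order.TTheory GRing.Theory Num.Theory Normc.
Import numFieldNormedType.Exports.

Local Open Scope classical_set_scope.
Local Open Scope complex_scope.
Local Open Scope ring_scope.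

Section Defs.
Context {R : realType}.
Implicit Types (f tau : R -> R[i]) (F : R[i] -> R[i]) (s z : R[i]).

Definition cexp z : R[i] :=
  (expR (complex.Re z))%:C * (cos (complex.Im z) +i* sin (complex.Im z)).

(* Meaningful when both parts of f are integrable on D; the library integral of a
   real function with no finite integral is a junk value. *)
Definition cintegral (D : set R) f : R[i] :=
  (\int[lebesgue_measure]_(t in D) complex.Re (f t)) +i*
  (\int[lebesgue_measure]_(t in D) complex.Im (f t)).

(* The space L^oo(0, +oo) of complex-valued functions; the values at t <= 0 are
   irrelevant. *)
Definition Linfty f : Prop :=
  [/\ measurable_fun (`]0, +oo[ : set R) (fun t => complex.Re (f t)),
      measurable_fun (`]0, +oo[ : set R) (fun t => complex.Im (f t)) &
      (ess_sup lebesgue_measure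
         (EFin \o ((fun t => normc (f t)) \_ `]0%R, +oo[)) < +oo)%E].

Definition laplace tau s : R[i] :=
  cintegral `]0, +oo[ (fun t => tau t * cexp (- (s * t%:C))).

Definition primitive tau (x : R) : R[i] := cintegral `]0, x] tau.

(* [^o] selects the norm topology of the field [R[i]] and its structure of normed
   module over itself, so that [derivable] is complex differentiability. *)
Definition holomorphic_on (U : set R[i]) F : Prop :=
  open (U : set R[i]^o) /\
  forall s, U s -> derivable (F : R[i]^o -> R[i]^o) s 1.

(* An analytic continuation to a set which need not be open is an analytic
   function on an open neighborhood of that set. *)
Definition laplace_continuation (Om : set R[i]) tau F : Prop :=
  (exists2 U : set R[i], Om `<=` U & holomorphic_on U F) /\
  (forall s, 0 < complex.Re s -> F s = laplace tau s).

Definition polynomial_growth (Om : set R[i]) F : Prop :=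
  exists A K : R, forall s, Om s -> normc (F s) <= A * (1 + normc s) `^ K.

Definition Omega (kappa C : R) : set R[i] :=
  [set s | - (C * ln (`|complex.Im s| + 2) / (1 + `|complex.Im s|) `^ kappa)
           <= complex.Re s].

Definition osc (kappa x : R) : R[i] := cexp ('i * (x `^ (1 + kappa^-1))%:C).

Definition osc_main_term (kappa x : R) : R[i] :=
  osc kappa x / ('i * ((1 + kappa^-1) * x `^ kappa^-1)%:C).

(* The filter of neighborhoods of +oo in R, packaged for the Landau notations. *)
Definition pinfty : filter_on R :=
  FilterType (pinfty_nbhs R) (@proper_pinfty_nbhs R).

(* The Tauberian statement on Om whose conclusion is that the error
   |int_0^x tau - L{tau; 0}|, as a function of x, satisfies [err]. *)
Definition tauberian (Om : set R[i]) (err : (R -> R) -> Prop) : Prop :=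
  forall tau F, Linfty tau -> laplace_continuation Om tau F ->
    polynomial_growth Om F ->
    err (fun x => normc (primitive tau x - F 0)).

(* The remainder O(g) cannot be replaced by o(g). *)
Definition optimal_error (Om : set R[i]) (g : R -> R) : Prop :=
  ~ tauberian Om (fun e => e =o_pinfty g).

End Defs.

(* Main.v *)
Require Import Defs.
From mathcomp Require Import all_boot all_order all_algebra.
From mathcomp Require Import all_classical all_reals all_analysis.
From mathcomp Require Import measurable_realfun ess_sup_inf.
From mathcomp Require Import ring lra.
Set Implicit Arguments.
Unset Strict Implicit.
Unset Printing Implicit Defensive.
Import Order.TTheory GRing.Theory Num.Theory Normc.
Import numFieldNormedType.Exports.
Local Open Scope classical_set_scope.
Local Open Scope ring_scope.

(** Put a = 1 + 1/kappa > 1.  Turning the half-line of integration by an angle phi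
    replaces the Laplace transform of exp(i x^a) by
      int_0^oo e^{i phi} exp(i r^a e^{i a phi} - s r e^{i phi}) dr,
    whose integrand has modulus exp(- decay), where
    decay = r^a sin(a phi) + r Re (s e^{i phi}).  For phi = 1/a the term r^a dominates
    every linear term, so this integral converges for all s and defines an entire
    function, [continuation]; differentiating under the integral gives
    [continuation_derivable].

    The angle can be changed without complex powers or contour integrals: the
    derivative of the integrand in phi is an exact derivative in r, so the integral
    over [0, T] has as derivative in phi a boundary term at T
    ([is_derive_integral_ray]), and Jordan's estimate [sector_le] shows that this
    term is negligible as T tends to infinity.  The resulting [cvg_rotated_integral]
    has three uses.  At angle 0 and Re s > 0 it identifies the continuation with the
    Laplace transform ([continuation_laplace]).  At angle 0 and s = 0 it gives the
    limit of the integral of exp(i t^a) over [0, n] ([cvg_integral_cos]).  At an angle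
    chosen in terms of s it gives the growth bound: for an angle of order
    log(|Im s| + 2) / (1 + |Im s|)^(1+kappa), both the loss allowed by Omega on Re s
    and the loss caused by the rotation are of order
    r log(|Im s| + 2) / (1 + |Im s|)^kappa, and the gain r^a sin(a phi) compensates
    them up to a constant multiple of log(|Im s| + 2) ([continuation_growth]).

    For the asymptotics, two integrations by parts suggest an explicit function
    [approx_primitive] whose derivative differs from exp(i x^a) by O(x^(-2-2/kappa));
    integrating this error from x to infinity gives the remainder
    ([primitive_expansion]).  The main term has modulus exactly x^(-1/kappa)/a, which
    excludes a remainder o(x^(-1/kappa)) ([primitive_osc_not_littleo]).

    All estimates are made on real functions: [ray s phi r beta] is the real part of
    e^{i beta} times the integrand, so that a statement for all beta covers both
    components, and multiplication by i is the shift of beta by pi/2. *)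

(** * Real functions *)

Section RealTools.
Context {R : realType}.
Implicit Types (f g : R -> R) (a b x y : R).
Notation mu := (@lebesgue_measure R).

(** Mean value inequality with a variable bound on the derivative.  It replaces
    integration of the bound wherever a primitive of the bound is known. *)
Lemma le_increment f g (f' g' : R -> R) a b : a <= b ->
  (forall x, x \in `]a, b[ -> is_derive x 1 f (f' x)) ->
  (forall x, x \in `]a, b[ -> is_derive x 1 g (g' x)) ->
  (forall x, x \in `]a, b[ -> `|f' x| <= g' x) ->
  {within `[a, b], continuous f} -> {within `[a, b], continuous g} ->
  `|f b - f a| <= g b - g a.
Proof.
rewrite le_eqVlt => /predU1P[<- *|ab df dg fg cf cg]; first by rewrite !subrr normr0.
(* Only e = 1 and e = - 1 are used: g - e f is nondecreasing. *)
have half (e : R) : `|e| = 1 -> e * (f b - f a) <= g b - g a.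
  move=> e1.
  have dh x : x \in `]a, b[ -> is_derive x 1 (g - e \*: f) (g' x - e * f' x).
    by move=> xab; have := df x xab; have := dg x xab => ? ?; apply: is_derive_eq.
  have ch : {within `[a, b], continuous (g - e \*: f)}.
    by move=> x; apply: cvgB; [exact: cg|apply: cvgZr; exact: cf].
  have [c cab] := MVT ab dh ch; rewrite !fctE => eq.
  have : 0 <= (g' c - e * f' c) * (b - a).
    rewrite mulr_ge0 ?subr_ge0 ?(ltW ab)// (le_trans _ (fg c cab))//.
    by rewrite (le_trans (ler_norm _))// normrM e1 mul1r.
  have -> : (g' c - e * f' c) * (b - a) = g b - e * f b - (g a - e * f a) by [].
  by lra.
rewrite ler_norml; have := half 1; have := half (-1).
by rewrite normrN normr1 => /(_ erefl) + /(_ erefl); lra.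
Qed.

Lemma integrable_expRN a K : 0 < a ->
  mu.-integrable `]0, +oo[ (EFin \o (fun r => expR (K - a * r))).
Proof.
move=> a0.
have H : mu.-integrable `]0, +oo[ (EFin \o exponential_pdf a).
  by apply: (@integrableS _ _ _ _ setT) => //; exact: integrable_exponential_pdf.
refine (@eq_integrable _ _ _ mu _ _
  (fun r => ((expR K / a)%:E * (exponential_pdf a r)%:E)%E) _ _ _) => //.
  move=> r; rewrite inE /= in_itv /= andbT => r0.
  by rewrite exponential_pdfE ?ltW// -EFinM expRD mulNr mulrA divfK ?gt_eqF// mulNr.
exact: integrableZl.
Qed.

Lemma integrable_dominated (D : set R) f g : measurable D -> measurable_fun D f ->
  (forall x, D x -> `|f x| <= g x) ->
  mu.-integrable D (EFin \o g) -> mu.-integrable D (EFin \o f).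
Proof.
move=> mD mf fg ig; apply: le_integrable ig => //; first exact/measurable_EFinP.
by move=> x Dx /=; rewrite lee_fin (le_trans (fg x Dx))// ler_norm.
Qed.

Lemma cvg_Rintegral_nat f : mu.-integrable `]0, +oo[ (EFin \o f) ->
  \int[mu]_(x in `]0, n%:R]) f x @[n --> \oo] --> \int[mu]_(x in `]0, +oo[) f x.
Proof.
move=> fi.
have /measurable_EFinP mf : measurable_fun (`]0, +oo[ : set R) (EFin \o f).
  by case/integrableP : fi.
have E n : \int[mu]_(x in `]0, n%:R]) f x =
    \int[mu]_(x in (`]0, +oo[ : set R)) (f \_ (`]0, n%:R] : set R)) x.
  rewrite -Rintegral_mkcondl; congr Rintegral.
  apply/seteqP; split => x /=; rewrite !in_itv /= ?andbT; last by case.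
  by move=> /andP[x0 ->]; rewrite x0.
under eq_fun do rewrite E.
apply: fine_cvg; rewrite fineK; last exact: integrable_fin_num.
apply: (@dominated_cvg _ _ _ mu _ _
   (fun n x => ((f \_ (`]0, n%:R] : set R)) x)%:E) _ (EFin \o (fun x => `|f x|))) => //=.
- move=> n; apply/measurable_EFinP; apply/measurable_restrict => //.
  by apply: measurable_funS mf => // x [].
- move=> x; rewrite in_itv/= andbT => x0; apply: cvg_EFin; first exact: nearW.
  apply: cvg_near_cst; near=> n; rewrite /= patchE ifT// inE /= in_itv /= x0 /=.
  by near: n; exact: nbhs_infty_ger.
- exact: integrable_norm.
- move=> n x _; rewrite lee_fin patchE; case: ifPn => // _.
  by rewrite normr0 normr_ge0.
Unshelve. all: by end_near. Qed.

Lemma integrable_continuous_cc f a b : continuous f ->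
  mu.-integrable `[a, b] (EFin \o f).
Proof.
move=> cf; apply: continuous_compact_integrable; first exact: segment_compact.
exact: continuous_subspaceT.
Qed.

(** By the mean value theorem, as cos decreases on [0, 1].  The constant cos 1 is
    not sharp; only its positivity matters. *)
Lemma sin_ge_cos1 x : 0 <= x <= 1 -> cos 1 * x <= sin x.
Proof.
move=> /andP[x0 x1].
have dh y : is_derive y (1:R) (sin - (cos 1) \*: id) (cos y - cos 1).
  apply: is_derive_eq; by rewrite /GRing.scale /= mulr1.
have ch : {within `[0, x], continuous (sin - (cos 1) \*: id)}.
  apply: continuous_subspaceT => y.
  by apply: differentiable_continuous; apply/derivable1_diffP; case: (dh y).
have [c] := MVT_segment x0 (fun y _ => dh y) ch.
rewrite in_itv /= !fctE sin0 => /andP[c0 cx] eq.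
have {}eq : sin x - cos 1 * x - (0 - cos 1 * 0) = (cos c - cos 1) * (x - 0) by [].
suff : 0 <= (cos c - cos 1) * (x - 0) by move: eq; lra.
rewrite mulr_ge0 ?subr0 // subr_ge0.
have c1 : c <= 1 by lra.
have p2 := @pi_ge2 R.
move: c1; rewrite le_eqVlt => /orP[/eqP->//|c1].
by rewrite ltW // ltr_cos // in_itv /=; lra.
Qed.

(** The superlinear function c r^a exceeds m r beyond r = (m/c)^(1/(a-1)), and below
    that point m r is at most the subtracted constant.  How this constant depends
    on m and c is what yields polynomial growth on the region Omega. *)
Lemma linear_le_powR (a c m r : R) : 1 < a -> 0 < c -> 0 <= m -> 0 <= r ->
  m * r - m * (m / c) `^ (a - 1)^-1 <= c * r `^ a.
Proof.
move=> a_gt1 c0 m0 r0; have a_gt0 : 0 < a by exact: lt_trans a_gt1.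
have a1 : 0 < a - 1 by rewrite subr_gt0.
have [rle|rgt] := lerP r ((m / c) `^ (a - 1)^-1).
  apply: (@le_trans _ _ 0); last by rewrite mulr_ge0 ?powR_ge0 ?(ltW c0).
  by rewrite -mulrBr mulr_ge0_le0// subr_le0.
apply: (@le_trans _ _ (m * r)).
  by rewrite gerBl mulr_ge0 ?powR_ge0.
rewrite -(mulr_powRB1 r0 a_gt0) mulrCA mulrC ler_wpM2l//.
rewrite mulrC -ler_pdivrMr//.
have -> : m / c = ((m / c) `^ (a - 1)^-1) `^ (a - 1).
  by rewrite -powRrM mulVf ?gt_eqF// powRr1 ?divr_ge0 ?(ltW c0).
by rewrite ge0_ler_powR ?nnegrE ?powR_ge0 ?(ltW a1) ?(ltW rgt).
Qed.

End RealTools.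

Section Derivatives.
Context {R : realType}.
Implicit Types (f g : R -> R) (x : R).

Lemma is_derive_expR_comp f x d : is_derive x 1 f d ->
  is_derive x 1 (fun y => expR (f y)) (d * expR (f x)).
Proof.
move=> df; have := @is_derive1_comp R expR f x _ _ (is_derive_expR (f x)) df.
by move=> h; apply: is_derive_eq h _; ring.
Qed.

Lemma is_derive_cos_comp f x d : is_derive x 1 f d ->
  is_derive x 1 (fun y => cos (f y)) (- d * sin (f x)).
Proof.
move=> df; have := @is_derive1_comp R cos f x _ _ (is_derive_cos (f x)) df.
by move=> h; apply: is_derive_eq h _; ring.
Qed.

Lemma is_derive_sin_comp f x d : is_derive x 1 f d ->
  is_derive x 1 (fun y => sin (f y)) (d * cos (f x)).
Proof.
move=> df; have := @is_derive1_comp R sin f x _ _ (is_derive_sin (f x)) df.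
by move=> h; apply: is_derive_eq h _; ring.
Qed.

Lemma is_derive_affine (m c x : R) : is_derive x 1 (fun y => m * y + c) m.
Proof.
have : is_derive x 1 ((m \*: id) + cst c : R -> R) (m + 0).
  by apply: is_derive_eq; rewrite /GRing.scale /= mulr1.
by rewrite addr0.
Qed.

Lemma is_derive_continuous f x d : is_derive x 1 f d -> {for x, continuous f}.
Proof.
by case=> df _; apply: differentiable_continuous; apply/derivable1_diffP.
Qed.

Lemma continuous_fun_add (f g : R -> R) : continuous f -> continuous g ->
  continuous (fun r => f r + g r).
Proof. by move=> cf cg r; exact: (continuousD (cf r) (cg r)). Qed.

Lemma continuous_fun_opp (f : R -> R) : continuous f -> continuous (fun r => - f r).
Proof. by move=> cf r; exact: (continuousN (cf r)). Qed.

Lemma continuous_fun_mul (f g : R -> R) : continuous f -> continuous g ->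
  continuous (fun r => f r * g r).
Proof. by move=> cf cg r; exact: (continuousM (cf r) (cg r)). Qed.

Lemma continuous_fun_scale (f : R -> R) (c : R) : continuous f -> continuous (fun r => f r * c).
Proof. by move=> cf; apply: continuous_fun_mul => // r; exact: cvg_cst. Qed.

Lemma continuous_fun_id : continuous (fun r : R => r). Proof. by move=> r; exact: cvg_id. Qed.

Lemma continuous_fun_cst (c : R) : continuous (fun _ : R => c). Proof. exact: cst_continuous. Qed.

Lemma continuous_fun_comp (f g : R -> R) : continuous f -> continuous g ->
  continuous (fun r => f (g r)).
Proof. by move=> cf cg r; exact: (continuous_comp (cg r) (cf _)). Qed.

Lemma norm_sin_le (phi : R) : 0 <= phi -> `|sin phi| <= phi.
Proof.
move=> p0.
have := @le_increment R sin id cos (fun=> 1) 0 phi p0 (fun x _ => is_derive_sin x)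
  (fun x _ => is_derive_id x 1) (fun x _ => cos_max x).
rewrite sin0 !subr0; apply; apply: continuous_subspaceT; first exact: continuous_sin.
exact: continuous_fun_id.
Qed.

End Derivatives.

(** * Complex numbers and the complex exponential *)

Section Complex.
Context {R : realType}.
Implicit Types (z w : R[i]).

Lemma ReD z w : complex.Re (z + w) = complex.Re z + complex.Re w.
Proof. by case: z; case: w. Qed.

Lemma ImD z w : complex.Im (z + w) = complex.Im z + complex.Im w.
Proof. by case: z; case: w. Qed.

Lemma ReB z w : complex.Re (z - w) = complex.Re z - complex.Re w.
Proof. by case: z; case: w. Qed.

Lemma ImB z w : complex.Im (z - w) = complex.Im z - complex.Im w.
Proof. by case: z; case: w. Qed.

Lemma ReM z w :
  complex.Re (z * w) = complex.Re z * complex.Re w - complex.Im z * complex.Im w.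
Proof. by case: z; case: w. Qed.

Lemma ImM z w :
  complex.Im (z * w) = complex.Re z * complex.Im w + complex.Im z * complex.Re w.
Proof. by case: z; case: w. Qed.

Lemma normcE z : `|z| = (normc z)%:C%C.
Proof. by case: z. Qed.

Definition re_im_norm z := `|complex.Re z| + `|complex.Im z|.

Lemma normc_sqr z : normc z ^+ 2 = complex.Re z ^+ 2 + complex.Im z ^+ 2.
Proof. by case: z => x y /=; rewrite sqr_sqrtr// addr_ge0 ?sqr_ge0. Qed.

Lemma normc_ge0 z : 0 <= normc z. Proof. by case: z => x y; exact: sqrtr_ge0. Qed.

Lemma normc_le_re_im z : normc z <= re_im_norm z.
Proof.
rewrite -(@ler_pXn2r _ 2) ?nnegrE ?normc_ge0 ?addr_ge0// normc_sqr.
rewrite -(real_normK (num_real (complex.Re z))) -(real_normK (num_real (complex.Im z))).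
by rewrite sqrrD addrAC lerDl mulrn_wge0// mulr_ge0.
Qed.

Lemma re_le_normc z : `|complex.Re z| <= normc z.
Proof.
rewrite -(@ler_pXn2r _ 2) ?nnegrE ?normc_ge0// normc_sqr.
by rewrite real_normK ?num_real// lerDl sqr_ge0.
Qed.

Lemma im_le_normc z : `|complex.Im z| <= normc z.
Proof.
rewrite -(@ler_pXn2r _ 2) ?nnegrE ?normc_ge0// normc_sqr.
by rewrite real_normK ?num_real// lerDr sqr_ge0.
Qed.

Lemma re_im_norm_le z : re_im_norm z <= 2 * normc z.
Proof. by rewrite mulr_natl mulr2n lerD ?re_le_normc ?im_le_normc. Qed.

Lemma normc_le2 z (B : R) : `|complex.Re z| <= B -> `|complex.Im z| <= B ->
  normc z <= 2 * B.
Proof.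
by move=> x y; rewrite (le_trans (normc_le_re_im z))// mulr_natl mulr2n lerD.
Qed.

(** Applied with x and y a cosine and a sine up to sign, this bounds the real and
    imaginary parts of z e^{i phi}. *)
Lemma trig_lin_le z (x y : R) : `|x| <= 1 -> `|y| <= 1 ->
  `|complex.Re z * x + complex.Im z * y| <= re_im_norm z.
Proof.
move=> x1 y1; apply: (le_trans (ler_normD _ _)).
by rewrite !normrM lerD// ler_piMr.
Qed.

(** The right-hand side is Re (z e^{i phi}). *)
Lemma rotated_re_ge z (phi : R) : 0 <= phi <= 1 ->
  - (Num.max (- complex.Re z) 0 + `|complex.Im z| * phi) <=
    complex.Re z * cos phi - complex.Im z * sin phi.
Proof.
move=> /andP[p0 p1].
have c0 : 0 <= cos phi.
  by apply: cos_ge0_pihalf; have := @pihalf_ge1 R; move: p0 p1; lra.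
rewrite opprD lerD//.
  have := cos_le1 phi; case: (leP (- complex.Re z) 0) => s0 c1.
    by rewrite oppr0 mulr_ge0// -oppr_le0.
  by rewrite opprK ler_niMr// ltW// -oppr_gt0.
rewrite lerN2 (le_trans (ler_norm _))// normrM ler_wpM2l//.
exact: norm_sin_le.
Qed.

Lemma cexpE z : cexp z = ((expR (complex.Re z) * cos (complex.Im z)) +i*
  (expR (complex.Re z) * sin (complex.Im z)))%C.
Proof. by apply/eqP; rewrite eq_complex /= !mul0r subr0 addr0 !eqxx. Qed.

Lemma cexpD z w : cexp (z + w) = cexp z * cexp w.
Proof.
rewrite !cexpE; case: z => x y; case: w => u v /=.
apply/eqP; rewrite eq_complex /= expRD cosD sinD.
by apply/andP; split; apply/eqP; ring.
Qed.

End Complex.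

(** * The integrand on a ray *)

Section Ray.
Context {R : realType}.
Variable a : R.
Hypothesis a_gt1 : 1 < a.
Implicit Types (s : R[i]) (phi r beta : R).

(** Powers of negative reals take the value 1, so that x |-> x^a is discontinuous at
    0; this variant agrees with it on r >= 0 and is continuous on the line. *)
Definition rpow r := Num.max r 0 `^ a.

(** On the ray z = r e^{i phi}, the function e^{i phi} exp(i z^a - s z) equals
    exp(- decay + i phase). *)
Definition decay s phi r :=
  rpow r * sin (a * phi) + r * (complex.Re s * cos phi - complex.Im s * sin phi).
Definition phase s phi r :=
  phi + rpow r * cos (a * phi) - r * (complex.Re s * sin phi + complex.Im s * cos phi).
(** The real part of e^{i beta} e^{i phi} exp(i z^a - s z) at z = r e^{i phi}.  The
    angle beta encodes complex multiplication: beta = 0 and beta = - pi/2 give the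
    real and imaginary parts, and adding pi/2 to beta multiplies by i. *)
Definition ray s phi r beta := expR (- decay s phi r) * cos (phase s phi r + beta).

(** The common value of the derivative in phi of the integrand W on the ray and of
    the derivative in r of i r W; it is the real part of e^{i beta} W times
    i - a r^a e^{i a phi} - i s r e^{i phi}. *)
Definition swirl s phi r beta :=
  (- a * rpow r * cos (a * phi)
     + r * (complex.Re s * sin phi + complex.Im s * cos phi)) * ray s phi r beta
  + (1 - a * rpow r * sin (a * phi)
     - r * (complex.Re s * cos phi - complex.Im s * sin phi)) *
    ray s phi r (beta + pi / 2).

Lemma rpow_ge0 r : 0 <= rpow r. Proof. exact: powR_ge0. Qed.

Lemma rpowE r : 0 <= r -> rpow r = r `^ a.
Proof. by move=> r0; rewrite /rpow max_l. Qed.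

Lemma is_derive_rpow r : 0 < r -> is_derive r 1 rpow (a * r `^ (a - 1)).
Proof.
move=> r0; have [d e] := is_derive1_powR a r0.
have E : {near r, (@powR R ^~ a) =1 rpow}.
  by near=> t; rewrite rpowE // ltW //; near: t; exact: lt_nbhsr.
split; first exact: near_eq_derivable E d.
by rewrite -e; apply/esym/near_eq_derive.
Unshelve. all: by end_near. Qed.

Lemma continuous_rpow : continuous rpow.
Proof.
move=> r; have [r0|r0|->] := ltgtP r 0.
- apply: cvg_near_cst; near=> t; rewrite /rpow !max_r ?(ltW r0) //.
  by apply/ltW; near: t; exact: lt_nbhsl.
- exact: is_derive_continuous (is_derive_rpow r0).
- suff : rpow x @[x --> (0 : R)] --> (0 : R).
    by rewrite /continuous_at [rpow 0]rpowE// powR0// gt_eqF ?(lt_trans _ a_gt1).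
  apply/cvgrPdist_le => e e0.
  have e1 : 0 < Num.min e 1 by rewrite lt_min e0 ltr01.
  have := @nbhs0_le R R _ e1; apply: filterS => t te.
  rewrite sub0r normrN ger0_norm ?rpow_ge0//.
  have [t0|t0] := lerP t 0.
    by rewrite /rpow max_r // powR0 ?gt_eqF ?(lt_trans _ a_gt1)// ltW.
  rewrite (rpowE (ltW t0)); rewrite gtr0_norm// le_min in te; case/andP: te => te t1.
  apply: (le_trans _ te); apply: ge1r_powR; last exact: ltW.
  by rewrite t0 t1.
Unshelve. all: by end_near. Qed.

Lemma ray_pi s phi r beta : ray s phi r (beta + pi / 2 + pi / 2) = - ray s phi r beta.
Proof. by rewrite /ray -[beta + _ + _]addrA -splitr addrA cosDpi mulrN. Qed.

Lemma ray_quarter s phi r beta :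
  ray s phi r (beta + pi / 2) = - (expR (- decay s phi r) * sin (phase s phi r + beta)).
Proof. by rewrite /ray addrA cosDpihalf mulrN. Qed.

Lemma is_derive_ray_angle s phi r beta :
  is_derive phi 1 (fun p => ray s p r beta) (swirl s phi r beta).
Proof.
have dsa : is_derive phi 1 (fun p : R => sin (a * p)) (a * cos (a * phi)).
  have := is_derive_affine a 0 phi; under eq_fun do rewrite addr0.
  exact: is_derive_sin_comp.
have dca : is_derive phi 1 (fun p : R => cos (a * p)) (- a * sin (a * phi)).
  have := is_derive_affine a 0 phi; under eq_fun do rewrite addr0.
  exact: is_derive_cos_comp.
pose x := complex.Re s; pose y := complex.Im s.
have dD : is_derive phi 1 (fun p => - decay s p r)
   (- (rpow r * (a * cos (a * phi)) + r * (x * - sin phi - y * cos phi))).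
  exact: is_deriveN (is_deriveD (is_deriveZ _ dsa) (is_deriveZ r
    (is_deriveB (is_deriveZ x (is_derive_cos phi)) (is_deriveZ y (is_derive_sin phi))))).
have dP : is_derive phi 1 (fun p => phase s p r + beta)
   (1 + rpow r * (- a * sin (a * phi)) - r * (x * cos phi + y * - sin phi) + 0).
  exact: is_deriveD (is_deriveB (is_deriveD (is_derive_id phi 1) (is_deriveZ _ dca))
    (is_deriveZ r (is_deriveD (is_deriveZ x (is_derive_sin phi))
      (is_deriveZ y (is_derive_cos phi))))) (is_derive_cst beta phi 1).
have := is_deriveM (is_derive_expR_comp dD) (is_derive_cos_comp dP).
move=> h; apply: is_derive_eq h _.
by rewrite /swirl ray_quarter /ray /GRing.scale /= -/x -/y; ring.
Qed.

(** Together with is_derive_ray_angle this is Cauchy's theorem in polar form: for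
    f holomorphic, d/dphi (e^{i phi} f(r e^{i phi})) = d/dr (i r e^{i phi} f(r e^{i phi})). *)
Lemma is_derive_ray_radius s phi r beta : 0 < r ->
  is_derive r 1 (fun t => t * ray s phi t (beta + pi / 2)) (swirl s phi r beta).
Proof.
move=> r0; have dr := is_derive_rpow r0.
pose x := complex.Re s; pose y := complex.Im s.
have dlin (c : R) : is_derive r 1 (fun t : R => t * c) c.
  by have := is_derive_affine c 0 r; under eq_fun do rewrite addr0 mulrC.
have drc (c : R) : is_derive r 1 (fun t : R => rpow t * c) (c * (a * r `^ (a - 1))).
  by have := is_deriveZ c dr; congr is_derive; apply/funext => t; rewrite mulrC.
have dD : is_derive r 1 (fun t => - decay s phi t)
   (- (sin (a * phi) * (a * r `^ (a - 1)) + (x * cos phi - y * sin phi))).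
  exact: is_deriveN (is_deriveD (drc _) (dlin _)).
have dP : is_derive r 1 (fun t => phase s phi t + (beta + pi / 2))
   (0 + cos (a * phi) * (a * r `^ (a - 1)) - (x * sin phi + y * cos phi) + 0).
  exact: is_deriveD (is_deriveB (is_deriveD (is_derive_cst phi r 1) (drc _)) (dlin _))
    (is_derive_cst _ r 1).
have := is_deriveM (is_derive_id r 1)
  (is_deriveM (is_derive_expR_comp dD) (is_derive_cos_comp dP)).
move=> h; apply: is_derive_eq h _.
have pE : rpow r = r * r `^ (a - 1).
  by rewrite rpowE ?ltW// mulr_powRB1 ?ltW// (lt_trans _ a_gt1).
rewrite /swirl ray_quarter /ray /GRing.scale /= -/x -/y mulrfctE.
by rewrite !(addrA (phase _ _ _)) cosDpihalf sinDpihalf pE; ring.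
Qed.

End Ray.

(** * Rotation of the ray of integration *)

Section Sector.
Context {R : realType}.
Variable a : R.
Hypothesis a_gt1 : 1 < a.
Implicit Types (s : R[i]) (phi r beta T : R).
Notation mu := (@lebesgue_measure R).
Notation ray := (ray a). Notation decay := (decay a). Notation phase := (phase a).
Notation swirl := (swirl a). Notation rpow := (rpow a).

Lemma norm_ray_le s phi r beta : `|ray s phi r beta| <= expR (- decay s phi r).
Proof.
by rewrite normrM ger0_norm ?expR_ge0// ler_piMr ?expR_ge0// cos_max.
Qed.

Lemma continuous_decay s phi : continuous (decay s phi).
Proof.
apply: (@continuous_fun_add R (fun r => rpow r * sin (a * phi))); apply: continuous_fun_scale.
  exact: continuous_rpow.
exact: continuous_fun_id.
Qed.

Lemma continuous_phase s phi : continuous (phase s phi).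
Proof.
apply: (@continuous_fun_add R (fun r => phi + rpow r * cos (a * phi))).
  by apply: continuous_fun_add; [exact: continuous_fun_cst|
    apply: continuous_fun_scale; exact: continuous_rpow].
by apply: continuous_fun_opp; apply: continuous_fun_scale; exact: continuous_fun_id.
Qed.

Lemma continuous_ray s phi beta : continuous (fun r => ray s phi r beta).
Proof.
apply: continuous_fun_mul; apply: continuous_fun_comp.
- exact: continuous_expR.
- by apply: continuous_fun_opp; exact: continuous_decay.
- exact: continuous_cos.
- by apply: continuous_fun_add; [exact: continuous_phase|exact: continuous_fun_cst].
Qed.

Lemma continuous_swirl s phi beta : continuous (fun r => swirl s phi r beta).
Proof.
have cp c d : continuous (fun r : R => c * rpow r * d).
  by apply: continuous_fun_scale; apply: continuous_fun_mul;
    [exact: continuous_fun_cst|exact: continuous_rpow].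
have cl c : continuous (fun r : R => r * c).
  by apply: continuous_fun_scale; exact: continuous_fun_id.
apply: continuous_fun_add; apply: continuous_fun_mul; try exact: continuous_ray.
  by apply: continuous_fun_add; [exact: cp|exact: cl].
apply: continuous_fun_add; last by apply: continuous_fun_opp; exact: cl.
by apply: continuous_fun_add; [exact: continuous_fun_cst|
  apply: continuous_fun_opp; exact: cp].
Qed.

(** The domination required to differentiate under the integral sign over [0, T]. *)
Lemma swirl_bounded s T : 0 < T -> exists2 G : R, 0 <= G &
  forall phi r beta, 0 <= r <= T -> `|swirl s phi r beta| <= G.
Proof.
move=> T0; pose M := rpow T + T * re_im_norm s.
have S0 : 0 <= re_im_norm s by rewrite addr_ge0.
have a0 : 0 < a by exact: lt_trans a_gt1.
have M0 : 0 <= M by rewrite addr_ge0 ?rpow_ge0 ?mulr_ge0 ?(ltW T0).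
exists ((1 + 2 * a * M) * expR M).
  by rewrite mulr_ge0 ?expR_ge0 ?addr_ge0 ?mulr_ge0 ?(ltW a0).
move=> phi r beta /andP[r0 rT].
have pT : rpow r <= rpow T.
  by rewrite (rpowE a r0) (rpowE a (ltW T0)) ge0_ler_powR ?nnegrE ?(ltW a0) ?(ltW T0).
have rS (x : R) : `|x| <= re_im_norm s -> `|r * x| <= T * re_im_norm s.
  by move=> xs; rewrite normrM (ger0_norm r0) ler_pM.
have pc (x : R) : `|x| <= 1 -> `|rpow r * x| <= rpow T.
  by move=> x1; rewrite normrM ger0_norm ?rpow_ge0// -[leRHS]mulr1 ler_pM// rpow_ge0.
have l1 := rS _ (trig_lin_le s (sin_max phi) (cos_max phi)).
have l2 : `|r * (complex.Re s * cos phi - complex.Im s * sin phi)| <= T * re_im_norm s.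
  by apply: rS; rewrite -mulrN; apply: trig_lin_le; rewrite ?normrN ?sin_max ?cos_max.
have E b : `|ray s phi r b| <= expR M.
  apply: le_trans (norm_ray_le _ _ _ _) _; rewrite ler_expR.
  apply: le_trans (ler_norm _) _; rewrite normrN.
  by apply: le_trans (ler_normD _ _) _; rewrite lerD// pc// sin_max.
have k1 := pc _ (cos_max (a * phi)); have k2 := pc _ (sin_max (a * phi)).
have aM : `|a| = a by rewrite gtr0_norm.
apply: le_trans (ler_normD _ _) _.
have A1 : `|- a * rpow r * cos (a * phi)
     + r * (complex.Re s * sin phi + complex.Im s * cos phi)| <= a * M.
  apply: le_trans (ler_normD _ _) _.
  rewrite -mulrA normrM normrN aM /M [leRHS]mulrDr lerD ?ler_pM2l//.
  by apply: (le_trans l1); rewrite ler_peMl ?mulr_ge0// ltW.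
have A2 : `|1 - a * rpow r * sin (a * phi)
     - r * (complex.Re s * cos phi - complex.Im s * sin phi)| <= 1 + a * M.
  apply: le_trans (ler_normB _ _) _.
  apply: (@le_trans _ _ (1 + a * rpow T + T * re_im_norm s)).
    rewrite lerD//; apply: le_trans (ler_normB _ _) _.
    by rewrite normr1 -mulrA normrM aM lerD2l ler_pM2l.
  by rewrite /M [in leRHS]mulrDr -addrA lerD2l lerD2l ler_peMl ?mulr_ge0// ltW.
apply: (@le_trans _ _ (a * M * expR M + (1 + a * M) * expR M)).
  by apply: lerD; rewrite normrM; apply: ler_pM.
by rewrite -mulrDl ler_wpM2r ?expR_ge0//; lra.
Qed.

(** Differentiating under the integral turns the derivative in phi into the integral
    over r of an exact derivative, so that only the boundary term at T remains. *)
Lemma is_derive_integral_ray s phi beta T : 0 < T ->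
  is_derive phi 1 (fun p => \int[mu]_(r in `[0, T]) ray s p r beta)
    (T * ray s phi T (beta + pi / 2)).
Proof.
move=> T0.
have [G G0 Gub] := swirl_bounded s T0.
pose f p r := ray s p r beta.
have Ia : `]phi - 1, phi + 1[%classic phi by rewrite /= in_itv /=; lra.
have d1f x y : partial1of2 f x y = swirl s x y beta.
  by rewrite partial1of2E; have [] := is_derive_ray_angle a s x y beta.
have intf x : `]phi - 1, phi + 1[%classic x -> mu.-integrable `[0, T] (EFin \o f x).
  by move=> _; apply: integrable_continuous_cc; exact: continuous_ray.
have derf x y : `]phi - 1, phi + 1[%classic x -> `[0, T]%classic y ->
    derivable (f ^~ y) x 1.
  by move=> _ _; have [] := is_derive_ray_angle a s x y beta.
have intG : mu.-integrable `[0, T] (EFin \o cst G).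
  by apply: integrable_continuous_cc; exact: cst_continuous.
have Gb x y : `]phi - 1, phi + 1[%classic x -> `[0, T]%classic y ->
    `|partial1of2 f x y| <= cst G y.
  by rewrite d1f /= in_itv /= => _ /Gub.
split.
  exact: (derivable_under_integral _ Ia intf derf (fun=> G0) intG Gb).
rewrite -derive1E (differentiation_under_integral _ Ia intf derf (fun=> G0) intG Gb)//.
under eq_Rintegral do rewrite d1f.
rewrite /Rintegral (@continuous_FTC2 _ _ (fun t => t * ray s phi t (beta + pi / 2)))//=.
- by rewrite mul0r subr0.
- by apply: continuous_subspaceT; exact: continuous_swirl.
- have cF : continuous (fun t : R => t * ray s phi t (beta + pi / 2)).
    by apply: continuous_fun_mul; [exact: continuous_fun_id|exact: continuous_ray].
  split.
  + move=> x; rewrite in_itv /= => /andP[x0 _].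
    by have [] := is_derive_ray_radius a_gt1 s phi beta x0.
  + by apply: cvg_at_right_filter; exact: cF.
  + by apply: cvg_at_left_filter; exact: cF.
- move=> x; rewrite in_itv /= => /andP[x0 _]; rewrite derive1E.
  by have [] := is_derive_ray_radius a_gt1 s phi beta x0.
Qed.

End Sector.

Section Arc.
Context {R : realType}.
Variable a : R.
Hypothesis a_gt1 : 1 < a.
Implicit Types (s : R[i]) (phi r beta T : R).
Notation mu := (@lebesgue_measure R).
Notation ray := (ray a). Notation decay := (decay a). Notation phase := (phase a).
Notation rpow := (rpow a).

Let a_gt0 : 0 < a. Proof. exact: lt_trans a_gt1. Qed.
Let c_gt0 : 0 < cos 1 :> R. Proof. exact: cos1_gt0. Qed.

(** The angle 1/a keeps a phi in [0, 1], where the sine dominates a linear function. *)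
Lemma decay_ge s phi r : 0 <= phi <= a^-1 -> 0 <= r ->
  cos 1 * (a * phi) * r `^ a + r * (complex.Re s * cos phi - complex.Im s * sin phi)
    <= decay s phi r.
Proof.
move=> /andP[p0 pa] r0; rewrite /decay lerD2r rpowE// mulrC ler_wpM2l ?powR_ge0//.
apply: sin_ge_cos1; rewrite mulr_ge0 ?(ltW a_gt0)//=.
by rewrite -(mulfV (lt0r_neq0 a_gt0)) ler_pM2l.
Qed.

(** On the ray of angle 1/a the term r^a, with a > 1, beats every linear term: the
    integral over this ray converges absolutely for all complex s. *)
Lemma decay_far (S b : R) : 0 <= S -> 0 <= b -> exists K, forall s r,
  re_im_norm s <= S -> 0 <= r -> b * r - K <= decay s a^-1 r.
Proof.
move=> S0 b0; exists ((S + b) * ((S + b) / cos 1) `^ (a - 1)^-1) => s r sS r0.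
have ia : 0 <= a^-1 <= a^-1 by rewrite lexx invr_ge0 (ltW a_gt0).
apply: le_trans (decay_ge s ia r0); rewrite mulfV ?gt_eqF// mulr1.
have H := linear_le_powR a_gt1 c_gt0 (addr_ge0 S0 b0) r0.
have : - (r * S) <= r * (complex.Re s * cos a^-1 - complex.Im s * sin a^-1).
  rewrite -mulrN ler_wpM2l// (le_trans (_ : _ <= - re_im_norm s)) ?lerN2//.
  have sN : `|- sin (a^-1 : R)| <= 1 by rewrite normrN sin_max.
  have := trig_lin_le s (cos_max a^-1) sN.
  by rewrite mulrN ler_norml => /andP[].
move: H; lra.
Qed.

Lemma integrable_ray s beta :
  mu.-integrable `]0, +oo[ (EFin \o (fun r => ray s a^-1 r beta)).
Proof.
have S0 : 0 <= re_im_norm s by rewrite addr_ge0.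
have [K HK] := decay_far S0 ler01.
apply: (@integrable_dominated _ _ _ (fun r => expR (K - 1 * r))) => //.
- apply: measurable_funTS; apply: continuous_measurable_fun.
  exact: continuous_ray.
- move=> r; rewrite /= in_itv /= andbT => r0.
  apply: le_trans (norm_ray_le _ _ _ _ _) _; rewrite ler_expR lerNl opprB.
  by apply: HK => //; exact: ltW.
- exact: integrable_expRN.
Qed.

Definition rotated_integral s beta := \int[mu]_(r in `]0, +oo[) ray s a^-1 r beta.

(** Jordan's lemma.  The two truncated integrals differ by the integral over the
    angle of the boundary term at T, which is at most T exp(- M phi) with M the
    denominator below; the integral of this bound is at most T / M. *)
Lemma sector_le s beta T B phi0 : 0 <= phi0 <= a^-1 -> 0 < T ->
  0 < cos 1 * a * T `^ a - B * T ->
  (forall phi, phi0 <= phi <= a^-1 ->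
    - (complex.Re s * cos phi - complex.Im s * sin phi) <= B * phi) ->
  `|\int[mu]_(r in `[0, T]) ray s a^-1 r beta
    - \int[mu]_(r in `[0, T]) ray s phi0 r beta|
  <= T / (cos 1 * a * T `^ a - B * T).
Proof.
move=> /andP[p0 pa] T0 M0 HB; set M := _ - _ in M0 *.
have dg phi : is_derive phi 1 (fun p : R => - (T / M) * expR (- M * p + 0))
    (T * expR (- M * phi + 0)).
  have := is_deriveZ (- (T / M)) (is_derive_expR_comp (is_derive_affine (- M) 0 phi)).
  move=> h; apply: is_derive_eq h _; rewrite /GRing.scale /=.
  by rewrite mulrA mulrNN divfK ?gt_eqF.
apply: le_trans (le_increment pa (fun phi _ => is_derive_integral_ray a_gt1 s phi beta T0)
  (fun phi _ => dg phi) _ _ _) _.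
- move=> phi; rewrite in_itv /= => /andP[p1 p2].
  rewrite normrM gtr0_norm// ler_pM2l//.
  apply: le_trans (norm_ray_le _ _ _ _ _) _; rewrite ler_expR addr0 mulNr lerN2.
  have pin : 0 <= phi <= a^-1 by apply/andP; split; lra.
  apply: le_trans (decay_ge s pin (ltW T0)).
  have : T * - (complex.Re s * cos phi - complex.Im s * sin phi) <= T * (B * phi).
    by rewrite ler_wpM2l ?(ltW T0)// HB//; apply/andP; split; lra.
  by rewrite /M; lra.
- apply: continuous_subspaceT => x; apply: is_derive_continuous.
  exact: (is_derive_integral_ray a_gt1 s x beta T0).
- apply: continuous_subspaceT => x; apply: is_derive_continuous; exact: dg.
rewrite !addr0.
have TM : 0 <= T / M by rewrite divr_ge0 ?ltW.
have e1 : expR (- M * phi0) <= 1.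
  by rewrite expR_le1 mulNr oppr_le0 mulr_ge0 ?(ltW M0).
have := mulr_ge0 TM (expR_ge0 (- M * a^-1)).
have : T / M * expR (- M * phi0) <= T / M * 1 by rewrite ler_wpM2l.
lra.
Qed.

(** Since a > 1, the denominator of sector_le grows faster than linearly. *)
Lemma sector_denominator (A B : R) : \forall n \near \oo,
  A * n%:R <= cos 1 * a * n%:R `^ a - B * n%:R.
Proof.
have m0 : 0 <= `|A| + `|B| + 1 by rewrite !addr_ge0.
have ca : 0 < cos 1 * a by rewrite mulr_gt0.
set K := ((`|A| + `|B| + 1) * ((`|A| + `|B| + 1) / (cos 1 * a)) `^ (a - 1)^-1).
near=> n.
have nK : K <= n%:R by near: n; exact: nbhs_infty_ger.
have n0 : 0 <= n%:R :> R by rewrite ler0n.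
have := linear_le_powR a_gt1 ca m0 n0; rewrite -/K.
have := ler_wpM2r n0 (ler_norm A); have := ler_wpM2r n0 (ler_norm B).
lra.
Unshelve. all: by end_near. Qed.

Lemma cvg_sector_bound (B : R) :
  (fun n : nat => n%:R / (cos 1 * a * n%:R `^ a - B * n%:R)) @ \oo --> (0 : R).
Proof.
apply/cvgrPdist_le => e e0; near=> n; rewrite sub0r normrN.
have n0 : 0 < n%:R :> R by rewrite ltr0n; near: n; exact: nbhs_infty_gt.
have H : e^-1 * n%:R <= cos 1 * a * n%:R `^ a - B * n%:R.
  by near: n; exact: sector_denominator.
have M0 : 0 < cos 1 * a * n%:R `^ a - B * n%:R.
  by apply: lt_le_trans H; rewrite mulr_gt0 ?invr_gt0.
rewrite ger0_norm; last by rewrite divr_ge0 ?(ltW n0) ?(ltW M0).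
by rewrite ler_pdivrMr// -ler_pdivrMl.
Unshelve. all: by end_near. Qed.

(** Rotation of the contour.  The hypothesis holds with phi0 = 0 when Re s >= 0,
    even if the integral over the half-line converges only conditionally, and with
    any phi0 > 0 for all s, at the price of a large B. *)
Lemma cvg_rotated_integral s beta phi0 B : 0 <= phi0 <= a^-1 ->
  (forall phi, phi0 <= phi <= a^-1 ->
    - (complex.Re s * cos phi - complex.Im s * sin phi) <= B * phi) ->
  (fun n : nat => \int[mu]_(r in `]0, n%:R]) ray s phi0 r beta) @ \oo -->
    rotated_integral s beta.
Proof.
move=> pin HB.
have lim := cvg_Rintegral_nat (integrable_ray s beta).
have oc phi n : \int[mu]_(r in `]0, n%:R]) ray s phi r beta =
    \int[mu]_(r in `[0, n%:R]) ray s phi r beta.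
  have i0n : mu.-integrable `[0, n%:R] (EFin \o (fun r => ray s phi r beta)).
    by apply: integrable_continuous_cc; exact: continuous_ray.
  apply: Rintegral_itv_obnd_cbnd; apply: integrableS i0n => //.
  by apply: subset_itvr; rewrite bnd_simp.
have d0 : (fun n : nat => \int[mu]_(r in `]0, n%:R]) ray s a^-1 r beta -
    \int[mu]_(r in `]0, n%:R]) ray s phi0 r beta) @ \oo --> (0 : R).
  apply: norm_cvg0; apply: (squeeze_cvgr _ (cvg_cst 0) (cvg_sector_bound B)).
  near=> n; rewrite normr_ge0 /= !oc; apply: (@sector_le s beta _ B) => //.
    by rewrite ltr0n; near: n; exact: nbhs_infty_gt.
  have n0 : 0 < n%:R :> R by rewrite ltr0n; near: n; exact: nbhs_infty_gt.
  apply: (@lt_le_trans _ _ (1 * n%:R)); first by rewrite mul1r.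
  by near: n; exact: sector_denominator.
rewrite [X in X @ \oo --> _](_ : _ = (fun n : nat =>
  \int[mu]_(r in `]0, n%:R]) ray s a^-1 r beta -
  (\int[mu]_(r in `]0, n%:R]) ray s a^-1 r beta -
   \int[mu]_(r in `]0, n%:R]) ray s phi0 r beta))); last first.
  by apply/funext => n; rewrite opprB addrC subrK.
by rewrite -[rotated_integral s beta]subr0; apply: cvgB; [exact: lim|exact: d0].
Unshelve. all: by end_near. Qed.

End Arc.

(** * The integral over a rotated ray *)

Section Continuation.
Context {R : realType}.
Variable a : R.
Hypothesis a_gt1 : 1 < a.
Implicit Types (s : R[i]) (phi r beta T : R).
Notation mu := (@lebesgue_measure R).
Notation ray := (ray a). Notation decay := (decay a).
Notation rotated_integral := (rotated_integral a).

Let a_gt0 : 0 < a. Proof. exact: lt_trans a_gt1. Qed.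

(** The integral of exp(i z^a - s z) over the ray of angle 1/a, an entire function
    of s. *)
Definition continuation s : R[i] :=
  (rotated_integral s 0 +i* rotated_integral s (- (pi / 2)))%C.

Lemma integral_exp_le (K m T : R) : 0 < m -> 0 < T ->
  \int[mu]_(r in `[0, T]) expR (K - m * r) <= expR K / m.
Proof.
move=> m0 T0.
have d (x : R) : is_derive x 1 (fun r : R => - m^-1 * expR (- m * r + K)) (expR (K - m * x)).
  have h := is_deriveZ (- m^-1) (is_derive_expR_comp (is_derive_affine (- m) K x)).
  apply: is_derive_eq h _; rewrite /GRing.scale /= mulrA mulrNN mulVf ?gt_eqF// mul1r.
  by rewrite addrC mulNr.
have c : continuous (fun r : R => - m^-1 * expR (- m * r + K)).
  by move=> x; exact: is_derive_continuous (d x).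
rewrite /Rintegral (@continuous_FTC2 _ _ (fun r : R => - m^-1 * expR (- m * r + K)))//=.
- rewrite mulr0 add0r !mulNr opprK addrC mulrC lerBlDr lerDl mulr_ge0 ?expR_ge0//.
  by rewrite invr_ge0 ltW.
- apply: continuous_subspaceT; apply: continuous_fun_comp; first exact: continuous_expR.
  apply: continuous_fun_add; first exact: continuous_fun_cst.
  by apply: continuous_fun_opp; apply: continuous_fun_mul;
    [exact: continuous_fun_cst|exact: continuous_fun_id].
- split.
  + by move=> x _; case: (d x).
  + by apply: cvg_at_right_filter; exact: c.
  + by apply: cvg_at_left_filter; exact: c.
- by move=> x _; rewrite derive1E; case: (d x).
Qed.

Lemma integral_ray_le s phi beta (m K T : R) : 0 < m -> 0 < T ->
  (forall r, 0 <= r -> m * r - K <= decay s phi r) ->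
  `|\int[mu]_(r in `]0, T]) ray s phi r beta| <= expR K / m.
Proof.
move=> m0 T0 HK.
have i0 : mu.-integrable `[0, T] (EFin \o (fun r => ray s phi r beta)).
  by apply: integrable_continuous_cc; exact: continuous_ray.
have cE : continuous (fun r : R => expR (K - m * r)).
  apply: continuous_fun_comp; first exact: continuous_expR.
  apply: continuous_fun_add; first exact: continuous_fun_cst.
  by apply: continuous_fun_opp; apply: continuous_fun_mul;
    [exact: continuous_fun_cst|exact: continuous_fun_id].
rewrite Rintegral_itv_obnd_cbnd; last first.
  by apply: integrableS i0 => //; apply: subset_itvr; rewrite bnd_simp.
apply: le_trans (integral_exp_le K m0 T0).
apply: le_trans (le_normr_Rintegral _ i0) _ => //.
apply: le_Rintegral => //.
- exact: integrable_norm.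
- exact: integrable_continuous_cc.
move=> r; rewrite /= in_itv /= => /andP[r0 _].
by apply: le_trans (norm_ray_le _ _ _ _ _) _; rewrite ler_expR lerNl opprB HK.
Qed.

(** The angle phi is free and may depend on s. *)
Lemma rotated_integral_le s phi beta (m K : R) : 0 < m -> 0 < phi <= a^-1 ->
  (forall r, 0 <= r -> m * r - K <= decay s phi r) ->
  `|rotated_integral s beta| <= expR K / m.
Proof.
move=> m0 /andP[p0 pa] HK.
have lim : (fun n : nat => \int[mu]_(r in `]0, n%:R]) ray s phi r beta) @ \oo -->
    rotated_integral s beta.
  (* max(- Re s, 0) <= (max(- Re s, 0) / phi) psi for every psi >= phi. *)
  apply: (@cvg_rotated_integral _ _ a_gt1 _ _ _
    (Num.max (- complex.Re s) 0 / phi + `|complex.Im s|)).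
    by rewrite (ltW p0).
  move=> psi /andP[q0 qa].
  have psi0 : 0 <= psi by move: p0 q0; lra.
  have psi1 : psi <= 1 by apply: (le_trans qa); rewrite invf_le1// ltW.
  have := @rotated_re_ge R s psi; rewrite psi0 psi1 => /(_ isT) H.
  rewrite lerNl; apply: le_trans H; rewrite lerN2 mulrDl lerD2r.
  rewrite mulrAC -mulrA ler_peMr ?le_max ?lexx ?orbT//.
  by rewrite ler_pdivlMr// mul1r.
apply: (cvgr_to_le (cvg_norm lim)).
near=> n; apply: integral_ray_le => //; rewrite ltr0n; near: n.
exact: nbhs_infty_gt.
Unshelve. all: by end_near. Qed.

End Continuation.

(** * Holomorphy of the continuation *)

Section Taylor.
Context {R : realType}.
Implicit Types x y b t : R.

(** The real part of e^{i b} e^{t (x + i y)}. *)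
Let wave x y b t := expR (x * t) * cos (y * t + b).

Let is_derive_wave x y b t :
  is_derive t 1 (wave x y b) (x * wave x y b t + y * wave x y (b + pi / 2) t).
Proof.
have d1 : is_derive t 1 (fun t : R => expR (x * t)) (x * expR (x * t)).
  have := is_derive_expR_comp (is_derive_affine x 0 t).
  by under eq_fun do rewrite addr0; rewrite addr0.
have h := is_deriveM d1 (is_derive_cos_comp (is_derive_affine y b t)).
apply: is_derive_eq h _.
by rewrite /wave addrA cosDpihalf /GRing.scale /=; ring.
Qed.

Let norm_wave_le x y b t : 0 <= t -> `|wave x y b t| <= expR ((`|x| + `|y|) * t).
Proof.
move=> t0; rewrite normrM ger0_norm ?expR_ge0//.
apply: (@le_trans _ _ (expR (x * t))); first by rewrite ler_piMr ?expR_ge0 ?cos_max.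
by rewrite ler_expR ler_wpM2r// (le_trans (ler_norm x))// lerDl.
Qed.

Let is_derive_expM m t : is_derive t 1 (fun t : R => expR (m * t)) (m * expR (m * t)).
Proof.
have := is_derive_expR_comp (is_derive_affine m 0 t).
by under eq_fun do rewrite addr0; rewrite addr0.
Qed.

Let wave_lipschitz x y b t : 0 <= t ->
  `|wave x y b t - cos b| <= expR ((`|x| + `|y|) * t) - 1.
Proof.
move=> t0; set M := `|x| + `|y|.
have w0 : wave x y b 0 = cos b by rewrite /wave !mulr0 expR0 mul1r add0r.
have e0 : expR (M * 0) = 1 by rewrite mulr0 expR0.
rewrite -w0 -[X in _ <= _ - X]e0.
apply: (@le_increment R (wave x y b) (fun t => expR (M * t)) _ _ 0 t t0
  (fun u _ => is_derive_wave x y b u) (fun u _ => is_derive_expM M u)).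
- move=> u; rewrite in_itv /= => /andP[u0 _].
  apply: le_trans (ler_normD _ _) _; rewrite (normrM x) (normrM y).
  have -> : M * expR (M * u) = `|x| * expR (M * u) + `|y| * expR (M * u).
    by rewrite /M; ring.
  by apply: lerD; apply: ler_wpM2l => //; apply: norm_wave_le; exact: ltW.
- by apply: continuous_subspaceT => u; exact: is_derive_continuous (is_derive_wave x y b u).
- by apply: continuous_subspaceT => u; exact: is_derive_continuous (is_derive_expM M u).
Qed.

(** This is |Re (e^{i b} (e^z - 1 - z))| <= M^2 e^M for z = x + i y, with M the sum of
    |x| and |y|.  Along t |-> e^{t z} the increments of e^{t z} and then of
    e^{t z} - t z are compared with those of e^{M t} and e^{M t} - M t. *)
Lemma exp_taylor2 x y b :
  `|expR x * cos (y + b) - cos b - (x * cos b - y * sin b)| <=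
    (`|x| + `|y|) ^+ 2 * expR (`|x| + `|y|).
Proof.
set M := `|x| + `|y|.
have M0 : 0 <= M by rewrite addr_ge0.
pose l := x * cos b - y * sin b.
have dl c (u : R) : is_derive u 1 (fun t : R => t * c) c.
  by have := is_derive_affine c 0 u; under eq_fun do rewrite addr0 mulrC.
have df (u : R) : is_derive u 1 (fun t : R => wave x y b t - t * l)
    (x * wave x y b u + y * wave x y (b + pi / 2) u - l).
  exact: is_deriveB (is_derive_wave x y b u) (dl l u).
have dg (u : R) : is_derive u 1 (fun t : R => expR (M * t) - t * M) (M * expR (M * u) - M).
  exact: is_deriveB (is_derive_expM M u) (dl M u).
have H := @le_increment R _ _ _ _ 0 1 ler01 (fun u _ => df u) (fun u _ => dg u).
have -> : expR x * cos (y + b) - cos b - (x * cos b - y * sin b) =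
   wave x y b 1 - 1 * l - (wave x y b 0 - 0 * l).
  by rewrite /wave !mulr1 !mulr0 expR0 !mul1r add0r mul0r subr0 addrAC.
apply: le_trans (H _ _ _) _.
- move=> u; rewrite in_itv /= => /andP[u0 _].
  have -> : x * wave x y b u + y * wave x y (b + pi / 2) u - l =
     x * (wave x y b u - cos b) + y * (wave x y (b + pi / 2) u - cos (b + pi / 2)).
    by rewrite cosDpihalf /l; ring.
  apply: le_trans (ler_normD _ _) _; rewrite (normrM x) (normrM y).
  have -> : M * expR (M * u) - M = `|x| * (expR (M * u) - 1) + `|y| * (expR (M * u) - 1).
    by rewrite /M; ring.
  by apply: lerD; apply: ler_wpM2l => //; apply: wave_lipschitz; exact: ltW.
- by apply: continuous_subspaceT => u; exact: is_derive_continuous (df u).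
- by apply: continuous_subspaceT => u; exact: is_derive_continuous (dg u).
rewrite mulr1 mulr0 expR0 mul1r mul0r subr0.
(* This is 1 - M <= e^{- M} multiplied by e^M. *)
have e1 : expR M - 1 <= M * expR M.
  have := expR_ge1Dx (- M); rewrite expRN => h.
  have : expR M * (1 - M) <= expR M * (expR M)^-1.
    by rewrite ler_wpM2l ?expR_ge0.
  by rewrite mulfV ?gt_eqF ?expR_gt0//; lra.
apply: (@le_trans _ _ (M * (expR M - 1))).
  by have := e1; lra.
by rewrite expr2 -mulrA ler_wpM2l.
Qed.

End Taylor.

Section Holomorphy.
Context {R : realType}.
Variable a : R.
Hypothesis a_gt1 : 1 < a.
Implicit Types (s h : R[i]) (phi r beta T : R).
Notation mu := (@lebesgue_measure R).
Notation ray := (ray a). Notation decay := (decay a). Notation phase := (phase a).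
Notation th := (a^-1).

(** The derivative in s of the integrand on the ray of angle 1/a is the integrand
    times - r e^{i/a}, whence the shift of beta by 1/a. *)
Definition ray_deriv s r beta := - (r * ray s th r (beta + th)).
Definition integral_deriv s beta := \int[mu]_(r in `]0, +oo[) ray_deriv s r beta.

Lemma integrable_ray_deriv s beta :
  mu.-integrable `]0, +oo[ (EFin \o (fun r => ray_deriv s r beta)).
Proof.
have S0 : 0 <= re_im_norm s by rewrite addr_ge0.
have [K HK] := decay_far a_gt1 S0 (ler0n _ 2).
apply: (@integrable_dominated _ _ _ (fun r => expR (K - 1 * r))) => //.
- apply: measurable_funTS; apply: continuous_measurable_fun.
  apply: continuous_fun_opp; apply: continuous_fun_mul;
    [exact: continuous_fun_id|exact: continuous_ray].
- move=> r; rewrite /= in_itv /= andbT => r0.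
  rewrite /ray_deriv normrN normrM gtr0_norm//.
  apply: (@le_trans _ _ (expR r * expR (- decay s th r))).
    apply: ler_pM; rewrite ?(ltW r0)//; last exact: norm_ray_le.
    by apply: le_trans (expR_ge1Dx r); rewrite lerDr.
  rewrite -expRD ler_expR; have := HK s r (lexx _) (ltW r0); lra.
- exact: integrable_expRN.
Qed.

(** The error of order r^2 |h|^2 e^{2 r} of the exponential is absorbed by five
    units of linear decay, four to cancel r^2 and e^{2 r} and one to integrate. *)
Lemma ray_taylor S : 0 <= S -> exists K, forall s h r beta,
  re_im_norm s <= S -> re_im_norm h <= 1 -> 0 <= r ->
  `|ray (s + h) th r beta - ray s th r beta -
     (complex.Re h * ray_deriv s r beta +
      complex.Im h * ray_deriv s r (beta + pi / 2))|
   <= re_im_norm h ^+ 2 * (4 * expR (K - 1 * r)).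
Proof.
move=> S0; have [K HK] := decay_far a_gt1 S0 (ler0n _ 5).
exists K => s h r beta sS hH r0.
have H0 : 0 <= re_im_norm h by rewrite addr_ge0.
pose x := - (r * (complex.Re h * cos th - complex.Im h * sin th)).
pose y := - (r * (complex.Re h * sin th + complex.Im h * cos th)).
pose b := phase s th r + beta.
have dD : - decay (s + h) th r = - decay s th r + x.
  by rewrite /decay ReD ImD /x; ring.
have pD : phase (s + h) th r + beta = y + b.
  by rewrite /b /phase ReD ImD /y; ring.
have -> : ray (s + h) th r beta - ray s th r beta -
     (complex.Re h * ray_deriv s r beta + complex.Im h * ray_deriv s r (beta + pi / 2)) =
   expR (- decay s th r) * (expR x * cos (y + b) - cos b - (x * cos b - y * sin b)).
  rewrite /ray_deriv (addrAC beta) ray_quarter /ray dD pD expRD !(addrA (phase _ _ _)) -/b.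
  by rewrite (cosD b) (sinD b) /x /y; ring.
have X1 : `|x| <= r * re_im_norm h.
  rewrite normrN normrM ger0_norm// ler_wpM2l// -mulrN.
  by apply: trig_lin_le; rewrite ?normrN ?cos_max ?sin_max.
have Y1 : `|y| <= r * re_im_norm h.
  rewrite normrN normrM ger0_norm// ler_wpM2l//.
  by apply: trig_lin_le; rewrite ?cos_max ?sin_max.
rewrite normrM ger0_norm ?expR_ge0//.
set M := `|x| + `|y|.
have M0 : 0 <= M by rewrite addr_ge0.
have MrH : M <= 2 * r * re_im_norm h by rewrite /M; move: X1 Y1; lra.
have M2 : M <= 2 * r by apply: (le_trans MrH); rewrite ler_piMr// mulr_ge0.
apply: (@le_trans _ _ (expR (- decay s th r) *
    ((2 * r * re_im_norm h) ^+ 2 * expR (2 * r)))).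
  rewrite ler_wpM2l ?expR_ge0//; apply: le_trans (exp_taylor2 _ _ _) _.
  apply: ler_pM; rewrite ?sqr_ge0 ?expR_ge0 ?ler_expR//.
  by rewrite ler_pXn2r ?nnegrE// !mulr_ge0.
have rE : r <= expR r by apply: le_trans (expR_ge1Dx r); rewrite lerDr.
(* Squaring r <= e^r. *)
have r2 : r ^+ 2 <= expR (2 * r).
  by rewrite expRM_natl ler_pXn2r ?nnegrE ?expR_ge0.
have -> : expR (- decay s th r) * ((2 * r * re_im_norm h) ^+ 2 * expR (2 * r)) =
  re_im_norm h ^+ 2 * (4 * (r ^+ 2 * (expR (2 * r) * expR (- decay s th r)))) by ring.
rewrite ler_wpM2l ?sqr_ge0// ler_wpM2l//.
apply: (@le_trans _ _ (expR (2 * r) * (expR (2 * r) * expR (- decay s th r)))).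
  by rewrite ler_wpM2r// mulr_ge0 ?expR_ge0.
by rewrite -!expRD ler_expR; have := HK s r sS r0; lra.
Qed.

Lemma rotated_integral_taylor s : exists2 J, 0 <= J & forall h beta,
  re_im_norm h <= 1 ->
  `|rotated_integral a (s + h) beta - rotated_integral a s beta -
     (complex.Re h * integral_deriv s beta +
      complex.Im h * integral_deriv s (beta + pi / 2))|
   <= re_im_norm h ^+ 2 * J.
Proof.
have S0 : 0 <= re_im_norm s by rewrite addr_ge0.
have [K HK] := ray_taylor S0.
have iE : mu.-integrable `]0, +oo[ (EFin \o (fun r => expR (K - 1 * r))).
  exact: integrable_expRN.
exists (4 * \int[mu]_(r in `]0, +oo[) expR (K - 1 * r)).
  by rewrite mulr_ge0// Rintegral_ge0// => r _; exact: expR_ge0.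
move=> h beta h1.
have iZ (c : R) f : mu.-integrable `]0, +oo[ (EFin \o f) ->
    mu.-integrable `]0, +oo[ (EFin \o (fun r => c * f r)).
  move=> fi; rewrite (_ : _ \o _ = fun r => (c%:E * (f r)%:E)%E)//; exact: integrableZl.
have i1 := integrable_ray a_gt1 (s + h) beta.
have i2 := integrable_ray a_gt1 s beta.
have i3 := iZ (complex.Re h) _ (integrable_ray_deriv s beta).
have i4 := iZ (complex.Im h) _ (integrable_ray_deriv s (beta + pi / 2)).
rewrite /rotated_integral /integral_deriv -!RintegralZl//; last 3 first.
- exact: iZ.
- exact: integrable_ray_deriv.
- exact: integrable_ray_deriv.
have i12 : mu.-integrable `]0, +oo[
    (EFin \o (fun r => ray (s + h) th r beta - ray s th r beta)).
  by rewrite (_ : _ \o _ = fun r => ((ray (s + h) th r beta)%:E - (ray s th r beta)%:E)%E)//;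
    exact: integrableB.
have i34 : mu.-integrable `]0, +oo[ (EFin \o (fun r => complex.Re h * ray_deriv s r beta
    + complex.Im h * ray_deriv s r (beta + pi / 2))).
  by rewrite (_ : _ \o _ = fun r => ((complex.Re h * ray_deriv s r beta)%:E
    + (complex.Im h * ray_deriv s r (beta + pi / 2))%:E)%E)//; exact: integrableD.
have i1234 : mu.-integrable `]0, +oo[
    (EFin \o (fun r => ray (s + h) th r beta - ray s th r beta -
    (complex.Re h * ray_deriv s r beta + complex.Im h * ray_deriv s r (beta + pi / 2)))).
  by rewrite (_ : _ \o _ = fun r => ((ray (s + h) th r beta - ray s th r beta)%:E -
    (complex.Re h * ray_deriv s r beta + complex.Im h * ray_deriv s r (beta + pi / 2))%:E)%E)//;
    exact: integrableB.
rewrite -RintegralB// -RintegralD// -RintegralB//.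
apply: le_trans (le_normr_Rintegral _ i1234) _ => //.
apply: le_Rintegral => //; first exact: integrable_norm.
  by apply: (iZ _ (fun r => 4 * expR (K - 1 * r))); exact: iZ.
by move=> r; rewrite /= in_itv /= andbT => r0; apply: HK => //; exact: ltW.
Qed.

End Holomorphy.

Section Derivable.
Context {R : realType}.
Variable a : R.
Hypothesis a_gt1 : 1 < a.
Implicit Types (s h : R[i]).

(** A quadratic first-order Taylor error gives complex differentiability. *)
Lemma complex_deriv (F : R[i] -> R[i]) s (L : R[i]) (J : R) : 0 <= J ->
  (forall h, normc h <= 2^-1 -> normc (F (s + h) - F s - h * L) <= J * normc h ^+ 2) ->
  derivable (F : R[i]^o -> R[i]^o) s 1.
Proof.
move=> J0 HJ; apply/cvg_ex; exists (L : R[i]^o).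
apply/cvgrPdist_le => e e0.
have {e0} [x x0 ->] : exists2 x : R, 0 < x & e = x%:C%C.
  by case: e e0 => x y; rewrite ltcE /= => /andP[/eqP -> x0]; exists x.
(* J + 1 in place of J keeps the quotient meaningful when J = 0. *)
pose d := Num.min 2^-1 (x / (J + 1)).
have J1 : 0 < J + 1 by rewrite ltr_wpDl.
have d0 : 0 < d by rewrite lt_min invr_gt0 ltr0n divr_gt0.
have d0C : 0 < d%:C%C :> R[i] by rewrite ltcR.
near=> h.
have hn0 : h != 0 by near: h; exact: nbhs_dnbhs_neq.
have hd : normc h <= d.
  by rewrite -lecR -normcE; near: h; exact: (@dnbhs0_le _ R[i]^o).
have [h12 hx] : normc h <= 2^-1 /\ normc h <= x / (J + 1).
  by move: hd; rewrite le_min => /andP[].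
have nh0 : 0 < normc h.
  by rewrite lt_neqAle normc_ge0 andbT eq_sym; apply: contra hn0 => /eqP /eq0_normc ->.
have -> : L - h^-1 *: (F (h *: 1 + s) - F s) = - (h^-1 * (F (s + h) - F s - h * L)).
  have -> : h^-1 *: (F (h *: 1 + s) - F s) = h^-1 * (F (h * 1 + s) - F s) by [].
  by rewrite mulr1 (addrC h) [in RHS]mulrBr mulKf// opprB.
rewrite normrN normcE lecR normcM normcV ler_pdivrMl//.
apply: (le_trans (HJ h h12)); rewrite expr2 mulrA mulrC ler_pM2l//.
apply: (le_trans (ler_wpM2l J0 hx)).
by rewrite mulrCA ler_piMr ?(ltW x0)// ler_pdivrMr// mul1r lerDl.
Unshelve. all: by end_near. Qed.

Lemma continuation_derivable s :
  derivable (continuation a : R[i]^o -> R[i]^o) s 1.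
Proof.
have [J J0 HJ] := rotated_integral_taylor a_gt1 s.
pose D b := integral_deriv a s b.
(* Multiplying by i twice changes the sign. *)
have Dpi : D (pi / 2) = - D (- (pi / 2)).
  rewrite /D /integral_deriv -[RHS]mulN1r -RintegralZl//; last exact: integrable_ray_deriv.
  apply: eq_Rintegral => r _; rewrite /ray_deriv.
  have -> : pi / 2 + a^-1 = - (pi / 2) + a^-1 + pi / 2 + pi / 2 :> R by ring.
  by rewrite ray_pi; ring.
apply: (@complex_deriv _ s (D 0 +i* D (- (pi / 2)))%C (8 * J)) => [|h h12].
  by rewrite mulr_ge0.
have hH : re_im_norm h <= 1 by rewrite (le_trans (re_im_norm_le h))// -ler_pdivlMl// mulr1.
apply: (@le_trans _ _ (2 * (re_im_norm h ^+ 2 * J))).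
  apply: normc_le2.
    have := HJ h 0 hH; rewrite add0r -/(D _) -/(D _) Dpi.
    by rewrite !ReB ReM /= mulrN.
  have := HJ h (- (pi / 2)) hH; rewrite addNr -/(D _) -/(D _).
  by rewrite !ImB ImM /=.
have : re_im_norm h ^+ 2 <= (2 * normc h) ^+ 2.
  by rewrite ler_pXn2r ?nnegrE ?mulr_ge0 ?normc_ge0 ?addr_ge0// re_im_norm_le.
move=> /(ler_wpM2r J0); lra.
Qed.

End Derivable.

(** * The Laplace transform and its growth *)

Section Osc.
Context {R : realType}.
Variable kappa : R.
Hypothesis kappa_gt0 : 0 < kappa.
Implicit Types (s : R[i]) (phi r beta T : R).
Notation mu := (@lebesgue_measure R).
Notation a := (1 + kappa^-1).

Let a_gt1 : 1 < a. Proof. by rewrite ltrDl invr_gt0. Qed.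
Let a_gt0 : 0 < a. Proof. exact: lt_trans a_gt1. Qed.

Lemma oscE x : osc kappa x = (cos (x `^ a) +i* sin (x `^ a))%C.
Proof.
rewrite /osc -complexiE cexpE /=.
by rewrite !mul0r !mul1r subr0 add0r expR0 !mul1r.
Qed.

Lemma normc_osc x : normc (osc kappa x) = 1.
Proof. by rewrite oscE /= cos2Dsin2 sqrtr1. Qed.

Lemma laplace_integrandE s r : 0 <= r ->
  osc kappa r * cexp (- (s * r%:C%C)) =
  (ray a s 0 r 0 +i* ray a s 0 r (- (pi / 2)))%C.
Proof.
move=> r0; rewrite /osc -cexpD cexpE /ray /decay /phase -complexiE.
case: s => x y /=; rewrite rpowE// !mulr0 sin0 cos0 !mul0r !mulr1 !mul1r !mulr0.
rewrite !addr0 !add0r !subr0 cosBpihalf.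
by rewrite oppr0 add0r ![r * _]mulrC.
Qed.

Lemma re_rot0 s : 0 <= complex.Re s -> forall phi, 0 <= phi <= a^-1 ->
  - (complex.Re s * cos phi - complex.Im s * sin phi) <= `|complex.Im s| * phi.
Proof.
move=> s0 phi /andP[p0 pa].
have p1 : phi <= 1 by apply: (le_trans pa); rewrite invf_le1// ltW.
have := @rotated_re_ge R s phi; rewrite p0 p1 => /(_ isT) H.
rewrite lerNl; apply: le_trans H; rewrite lerN2.
by rewrite max_r ?add0r// oppr_le0.
Qed.

Lemma cvg_ray0 s beta : 0 <= complex.Re s ->
  (fun n : nat => \int[mu]_(r in `]0, n%:R]) ray a s 0 r beta) @ \oo -->
    rotated_integral a s beta.
Proof.
move=> s0; apply: (@cvg_rotated_integral _ _ a_gt1 _ _ _ `|complex.Im s|).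
  by rewrite lexx invr_ge0 ltW.
exact: re_rot0.
Qed.

Lemma continuation_laplace s : 0 < complex.Re s ->
  continuation a s = laplace (osc kappa) s.
Proof.
move=> s0.
have ir beta : mu.-integrable `]0, +oo[ (EFin \o (fun r => ray a s 0 r beta)).
  apply: (@integrable_dominated _ _ _ (fun r => expR (0 - complex.Re s * r))) => //.
  - apply: measurable_funTS; apply: continuous_measurable_fun.
    exact: continuous_ray.
  - move=> r; rewrite /= in_itv /= andbT => r0.
    apply: le_trans (norm_ray_le _ _ _ _ _) _; rewrite ler_expR /decay.
    by rewrite !mulr0 sin0 cos0 !mulr0 mulr1 subr0 add0r sub0r mulrC.
  - exact: integrable_expRN.
have E beta : rotated_integral a s beta = \int[mu]_(r in `]0, +oo[) ray a s 0 r beta.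
  rewrite -(cvg_lim (@Rhausdorff R) (@cvg_ray0 s beta (ltW s0))).
  by apply: (cvg_lim (@Rhausdorff R)); apply: cvg_Rintegral_nat.
have pos (r : R) : (`]0, +oo[%classic : set R) r -> 0 < r by rewrite /= in_itv /= andbT.
rewrite /continuation !E /laplace /cintegral; congr (_ +i* _)%C.
  apply: eq_Rintegral => r; rewrite inE => ir0; have := pos _ ir0 => r0.
  by rewrite (laplace_integrandE s (ltW r0)).
apply: eq_Rintegral => r; rewrite inE => ir0; have := pos _ ir0 => r0.
by rewrite (laplace_integrandE s (ltW r0)).
Qed.

Lemma primitiveE T : primitive (osc kappa) T =
  (\int[mu]_(r in `]0, T]) cos (rpow a r) +i* \int[mu]_(r in `]0, T]) sin (rpow a r))%C.
Proof.
have pos (r : R) : (`]0, T]%classic : set R) r -> 0 <= r.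
  by rewrite /= in_itv /= => /andP[/ltW].
rewrite /primitive /cintegral; congr (_ +i* _)%C.
  apply: eq_Rintegral => r; rewrite inE => ir0; have := pos _ ir0 => r0.
  by rewrite oscE rpowE.
apply: eq_Rintegral => r; rewrite inE => ir0; have := pos _ ir0 => r0.
by rewrite oscE rpowE.
Qed.

(** For s = 0 the rotation of the contour identifies the conditionally convergent
    integral of exp(i x^a) over the half-line with the value of the continuation
    at 0. *)
Lemma cvg_integral_cos beta :
  (fun n : nat => \int[mu]_(r in `]0, n%:R]) cos (rpow a r + beta)) @ \oo -->
    rotated_integral a 0 beta.
Proof.
suff -> : (fun n : nat => \int[mu]_(r in `]0, n%:R]) cos (rpow a r + beta)) =
  (fun n : nat => \int[mu]_(r in `]0, n%:R]) ray a 0 0 r beta).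
  exact: cvg_ray0.
apply/funext => n; apply: eq_Rintegral => r _.
rewrite /ray /decay /phase /= !mulr0 sin0 cos0 !mul0r !mulr0 subrr mulr0.
by rewrite !addr0 oppr0 expR0 mul1r mulr0 subr0 add0r mulr1.
Qed.

(** Write t = |Im s|, N = 1 + t and L = log(t + 2).  At the angle L / (a N^(1+kappa))
    the terms of the exponent that are linear in r cost at most (C + 1) q r with
    q = L / N^kappa, and r^a sin(a phi) compensates (C + 2) q r up to a constant
    D L, because 1/(a-1) = kappa.  The integrand is then at most exp(D L - q r),
    whose integral (t + 2)^D / q is polynomial in t. *)
Lemma continuation_growth C : 0 < C ->
  polynomial_growth (Omega kappa C) (continuation a).
Proof.
move=> C0.
have l2 : 0 < ln (2 : R) by rewrite ln_gt0// ltr1n.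
have c1 := @cos1_gt0 R.
pose D := (C + 2) * ((C + 2) / cos 1) `^ kappa.
have D0 : 0 <= D by rewrite mulr_ge0 ?powR_ge0// addr_ge0 ?ltW.
exists (2 * (2 `^ D / ln 2)), (D + kappa) => s s_in.
have sO : - (C * ln (`|complex.Im s| + 2) / (1 + `|complex.Im s|) `^ kappa) <=
    complex.Re s := s_in.
set t := `|complex.Im s| in sO.
have t0 : 0 <= t := normr_ge0 _.
set L := ln (t + 2) in sO; set N := (1 + t) in sO.
have N1 : 1 <= N by rewrite lerDl.
have N0 : 0 < N by exact: lt_le_trans N1.
have L2 : ln 2 <= L by rewrite ler_ln ?posrE ?lerDr// ltr_wpDl.
have L0 : 0 < L := lt_le_trans l2 L2.
have LN : L <= N.
  rewrite /L (_ : t + 2 = 1 + N); last by rewrite /N; ring.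
  apply: le_ln1Dx; exact: lt_trans N0.
have Nk : 0 < N `^ kappa by exact: powR_gt0.
have Nk1 : 1 <= N `^ kappa by rewrite -(powRr0 N) ler_powR// ltW.
pose q := L / N `^ kappa.
have q0 : 0 < q by rewrite divr_gt0.
(* The bound L <= N makes this angle at most 1/a. *)
pose phi := a^-1 * (L / (N * N `^ kappa)).
have phi0 : 0 < phi by rewrite mulr_gt0 ?invr_gt0 ?divr_gt0 ?mulr_gt0.
have phia : phi <= a^-1.
  rewrite ler_piMr ?invr_ge0 ?(ltW a_gt0)// ler_pdivrMr ?mulr_gt0// mul1r.
  by apply: (le_trans LN); rewrite ler_peMr// ltW.
have phi1 : phi <= 1 by apply: (le_trans phia); rewrite invf_le1// ltW.
have aphi : a * phi = q / N.
  by rewrite /phi mulrA mulfV ?gt_eqF// mul1r /q -mulrA -invfM [_ * N]mulrC.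
have decq r : 0 <= r -> q * r - D * L <= decay a s phi r.
  move=> r0.
  have pin : 0 <= phi <= a^-1 by rewrite (ltW phi0).
  apply: le_trans (decay_ge a_gt1 s pin r0).
  have Hrot : - ((C + 1) * q) <= complex.Re s * cos phi - complex.Im s * sin phi.
    have := @rotated_re_ge R s phi; rewrite (ltW phi0) phi1 => /(_ isT).
    apply: le_trans; rewrite lerN2 mulrDl mul1r lerD//.
      rewrite ge_max; apply/andP; split; last by rewrite mulr_ge0 ?(ltW C0) ?(ltW q0).
      by rewrite lerNl mulrA.
    rewrite -/t; apply: (@le_trans _ _ (N * phi)).
      by rewrite ler_wpM2r ?(ltW phi0)// lerDr.
    have -> : N * phi = a^-1 * q.
      by rewrite /phi mulrCA; congr (_ * _); rewrite /q; field; rewrite !gt_eqF.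
    by rewrite ler_piMl ?(ltW q0)// invf_le1// ltW.
  have Hr := ler_wpM2l r0 Hrot.
  have cc : 0 < cos 1 * (q / N) by rewrite mulr_gt0 ?divr_gt0.
  have mm : 0 <= (C + 2) * q by rewrite mulr_ge0 ?(ltW q0) ?addr_ge0 ?ltW.
  have := linear_le_powR a_gt1 cc mm r0.
  have -> : (a - 1)^-1 = kappa by rewrite addrAC subrr add0r invrK.
  have -> : (C + 2) * q / (cos 1 * (q / N)) = (C + 2) / cos 1 * N.
    by field; rewrite !gt_eqF.
  have -> : (C + 2) * q * ((C + 2) / cos 1 * N) `^ kappa = D * L.
    rewrite powRM ?(ltW N0)//; last by rewrite divr_ge0 ?(ltW c1)// addr_ge0 ?ltW.
    by rewrite /D /q; field; rewrite gt_eqF.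
  by rewrite aphi; move: Hr; lra.
have comp_le beta : `|rotated_integral a s beta| <= 2 `^ D / ln 2 * (1 + normc s) `^ (D + kappa).
  have p2 : 0 < phi <= a^-1 by rewrite phi0.
  apply: (le_trans (rotated_integral_le a_gt1 beta q0 p2 decq)).
  have ts : t <= normc s := im_le_normc s.
  have S0 : 0 < 1 + normc s by rewrite ltr_pwDl// normc_ge0.
  have -> : expR (D * L) = (t + 2) `^ D by rewrite /powR gt_eqF// ltr_wpDl.
  rewrite /q invf_div powRD; last by rewrite (gt_eqF S0) implybT.
  apply: (@le_trans _ _ ((2 * (1 + normc s)) `^ D * ((1 + normc s) `^ kappa / ln 2))).
    have h1 : (t + 2) `^ D <= (2 * (1 + normc s)) `^ D.
      by apply: ge0_ler_powR => //; rewrite ?nnegrE; have := normc_ge0 s; move: ts t0; lra.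
    have h2 : N `^ kappa <= (1 + normc s) `^ kappa.
      by rewrite ge0_ler_powR ?nnegrE ?(ltW S0) ?(ltW N0) ?(ltW kappa_gt0) ?lerD.
    have h3 : L^-1 <= (ln 2)^-1 by rewrite lef_pV2 ?posrE.
    have L0' : 0 <= L^-1 by rewrite invr_ge0 ltW.
    apply: (ler_pM _ _ h1 _); rewrite ?powR_ge0//; first by rewrite mulr_ge0 ?powR_ge0.
    by apply: (ler_pM _ _ h2 h3); rewrite ?powR_ge0.
  by rewrite powRM ?(ltW S0)// le_eqVlt; apply/orP; left; apply/eqP; ring.
apply: (le_trans (normc_le_re_im _)).
rewrite -mulrA mulr_natl mulr2n lerD//; exact: comp_le.
Qed.

End Osc.

(** * Asymptotics of the primitive and optimality *)

Section Asymptotics.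
Context {R : realType}.
Variable kappa : R.
Hypothesis kappa_gt0 : 0 < kappa.
Implicit Types (x t beta : R).
Notation mu := (@lebesgue_measure R).
Notation a := (1 + kappa^-1).
Notation rpow := (rpow a).

Let a_gt1 : 1 < a. Proof. by rewrite ltrDl invr_gt0. Qed.
Let a_gt0 : 0 < a. Proof. exact: lt_trans a_gt1. Qed.

Let k := kappa^-1 / a ^+ 2.
Let k_ge0 : 0 <= k. Proof. by rewrite divr_ge0 ?sqr_ge0 ?invr_ge0 ?ltW. Qed.

(** The real part of e^{i beta} times the first two terms of the expansion of a
    primitive of exp(i x^a) obtained by integrating by parts twice. *)
Definition approx_primitive beta t :=
  a^-1 * t `^ (- kappa^-1) * sin (t `^ a + beta)
  - k * t `^ (- 1 - 2 / kappa) * cos (t `^ a + beta).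

(** The coefficient k makes the two sine terms, of order t^(-a), cancel. *)
Lemma is_derive_approx beta t : 0 < t ->
  is_derive t 1 (approx_primitive beta)
    (cos (t `^ a + beta)
     + k * (1 + 2 / kappa) * t `^ (- 1 - 2 / kappa - 1) * cos (t `^ a + beta)).
Proof.
move=> t0.
have du : is_derive t 1 (fun t => t `^ a + beta) (a * t `^ (a - 1) + 0).
  exact: is_deriveD (is_derive1_powR a t0) (is_derive_cst beta t 1).
have d1 := is_deriveM (is_deriveZ a^-1 (is_derive1_powR (- kappa^-1) t0)) (is_derive_sin_comp du).
have d2 := is_deriveM (is_deriveZ k (is_derive1_powR (- 1 - 2 / kappa) t0)) (is_derive_cos_comp du).
have h := is_deriveB d1 d2.
apply: is_derive_eq h _.
have k0 : kappa != 0 by rewrite gt_eqF.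
have a0 : a != 0 by rewrite gt_eqF.
have e1 : a - 1 = kappa^-1 by rewrite addrAC subrr add0r.
have p1 : t `^ (- kappa^-1) * t `^ kappa^-1 = 1.
  by rewrite -powRD ?addNr ?powRr0// (gt_eqF t0) implybT.
have p2 : t `^ (- 1 - 2 / kappa) * t `^ kappa^-1 = t `^ (- kappa^-1 - 1).
  rewrite -powRD ?(gt_eqF t0) ?implybT//; congr (_ `^ _); by field.
rewrite /GRing.scale /= e1 addr0.
set S := sin _; set Co := cos _; set X := t `^ (- kappa^-1) in p1 *.
set Y := t `^ kappa^-1 in p1 p2 *; set Z := t `^ (- 1 - 2 / kappa) in p2 *.
rewrite -p2 /k; move: (t `^ (- 1 - 2 / kappa - 1)) => W.
(* K stands for 1/kappa and A for a = 1 + 1/kappa, as independent variables. *)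
have alg (A K : R) : A != 0 ->
    A^-1 * X * (A * Y * Co) + S * (A^-1 * (- K * (Z * Y))) -
    (K / A ^+ 2 * Z * (- (A * Y) * S) + Co * (K / A ^+ 2 * ((- 1 - 2 * K) * W))) =
    Co + K / A ^+ 2 * (1 + 2 * K) * W * Co.
  by move=> A0; rewrite -[X in _ = X + _](mul1r Co) -p1; field.
exact: (alg _ kappa^-1 a0).
Qed.

Lemma is_derive_primitive beta t : 0 < t ->
  is_derive t 1 (fun x => \int[mu]_(r in `]0, x]) cos (rpow r + beta))
    (cos (t `^ a + beta)).
Proof.
move=> t0.
have cf : continuous (fun r : R => cos (rpow r + beta)).
  apply: continuous_fun_comp; first exact: continuous_cos.
  by apply: continuous_fun_add; [exact: continuous_rpow|exact: continuous_fun_cst].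
have i1 : mu.-integrable `[0, t + 1] (EFin \o (fun r : R => cos (rpow r + beta))).
  exact: integrable_continuous_cc.
have i0 : mu.-integrable `]0, t + 1] (EFin \o (fun r : R => cos (rpow r + beta))).
  by apply: integrableS i1 => //; apply: subset_itvr; rewrite bnd_simp.
have tt1 : t < t + 1 by rewrite ltrDl.
have b0t : (BRight 0 < BRight t)%O by rewrite bnd_simp.
have [] := continuous_FTC1 tt1 i0 b0t (cf t).
move=> d e; split => //; rewrite -derive1E e rpowE//; exact: ltW.
Qed.

Lemma cvg_powRN (p : R) : 0 < p -> x `^ (- p) @[x --> +oo] --> (0 : R).
Proof.
move=> p0; apply/cvgrPdist_le => e e0; near=> x.
have x0 : 0 < x by near: x; exact: nbhs_pinfty_gt.
have xe : (e^-1) `^ p^-1 <= x by near: x; exact: nbhs_pinfty_ge.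
rewrite sub0r normrN ger0_norm ?powR_ge0// powRN.
rewrite -[leRHS]invrK lef_pV2 ?posrE ?invr_gt0 ?powR_gt0//.
rewrite -[leLHS]powRr1 ?invr_ge0 ?(ltW e0)// -(mulVf (lt0r_neq0 p0)) powRrM.
by rewrite ge0_ler_powR ?nnegrE ?powR_ge0 ?(ltW p0) ?(ltW x0).
Unshelve. all: by end_near. Qed.

Let e1_gt0 : 0 < 1 + 2 / kappa.
Proof. by rewrite addr_gt0// divr_gt0. Qed.
Let e1E : - 1 - 2 / kappa = - (1 + 2 / kappa). Proof. by rewrite opprD. Qed.

Lemma cvg_approx beta : approx_primitive beta n%:R @[n --> \oo] --> (0 : R).
Proof.
have h1 := cvg_comp _ _ (@cvgr_idn R) (cvg_powRN (p := kappa^-1) _).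
have h2 := cvg_comp _ _ (@cvgr_idn R) (cvg_powRN e1_gt0).
have ik : 0 < kappa^-1 by rewrite invr_gt0.
have l1 : (fun n : nat => a^-1 * n%:R `^ (- kappa^-1) + k * n%:R `^ (- 1 - 2 / kappa)) @ \oo
    --> (0 : R).
  rewrite -[X in _ --> X]addr0 -[X in _ --> X + _](mulr0 a^-1) -[X in _ --> _ + X](mulr0 k).
  apply: cvgD; apply: cvgM; try exact: cvg_cst; first exact: h1.
  by rewrite e1E; exact: h2.
apply: norm_cvg0; apply: (squeeze_cvgr _ (cvg_cst 0) l1).
near=> n; rewrite normr_ge0 /=; apply: le_trans (ler_normB _ _) _.
rewrite (normrM (a^-1 * _)) (normrM (k * _)) (normrM a^-1) (normrM k).
rewrite (ger0_norm k_ge0) (ger0_norm (powR_ge0 _ _)).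
have ai : 0 <= a^-1 by rewrite invr_ge0 ltW.
rewrite (ger0_norm ai) (ger0_norm (powR_ge0 _ _)).
apply: lerD; apply: ler_piMr; rewrite ?sin_max ?cos_max//.
  exact: (mulr_ge0 ai (powR_ge0 _ _)).
exact: (mulr_ge0 k_ge0 (powR_ge0 _ _)).
Unshelve. all: by end_near. Qed.

(** The difference between the primitive and its approximation varies on [x, y] by
    at most k x^(-1-2/kappa), uniformly in y; letting y tend to infinity through
    the integers identifies the constant of integration. *)
Lemma primitive_expansion beta x : 0 < x ->
  `|\int[mu]_(r in `]0, x]) cos (rpow r + beta) -
    (rotated_integral a 0 beta + approx_primitive beta x)|
   <= k * x `^ (- 1 - 2 / kappa).
Proof.
move=> x0; pose G x := \int[mu]_(r in `]0, x]) cos (rpow r + beta).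
pose b t := - k * t `^ (- 1 - 2 / kappa).
have db t : 0 < t -> is_derive t 1 b (k * (1 + 2 / kappa) * t `^ (- 1 - 2 / kappa - 1)).
  move=> t0; have h := is_deriveZ (- k) (is_derive1_powR (- 1 - 2 / kappa) t0).
  by apply: is_derive_eq h _; rewrite /GRing.scale /=; ring.
have df t : 0 < t -> is_derive t 1 (fun x => G x - approx_primitive beta x)
   (- (k * (1 + 2 / kappa) * t `^ (- 1 - 2 / kappa - 1) * cos (t `^ a + beta))).
  move=> t0; have h := is_deriveB (is_derive_primitive beta t0) (is_derive_approx beta t0).
  by apply: is_derive_eq h _; ring.
have step y : x <= y ->
   `|G y - approx_primitive beta y - (G x - approx_primitive beta x)| <= k * x `^ (- 1 - 2 / kappa).
  move=> xy.
  have pos t : t \in `]x, y[ -> 0 < t.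
    by rewrite in_itv /= => /andP[xt _]; exact: lt_trans xt.
  have pos' t : t \in `[x, y] -> 0 < t.
    by rewrite in_itv /= => /andP[xt _]; exact: lt_le_trans xt.
  have cw (f f' : R -> R) : (forall t, 0 < t -> is_derive t 1 f (f' t)) ->
      {within `[x, y], continuous f}.
    move=> d; apply: derivable_within_continuous => t /pos' /d.
    by case.
  have := le_increment xy (fun t h => df t (pos t h)) (fun t h => db t (pos t h)) _
    (cw _ _ df) (cw _ _ db).
  move=> /(_ _)/le_trans; apply.
    move=> t _; rewrite normrN.
    have D0 := mulr_ge0 (mulr_ge0 k_ge0 (ltW e1_gt0)) (powR_ge0 t (- 1 - 2 / kappa - 1)).
    by rewrite normrM (ger0_norm D0) ler_piMr ?cos_max.
  have := mulr_ge0 k_ge0 (powR_ge0 y (- 1 - 2 / kappa)); rewrite /b.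
  move: (k) => k'; lra.
have l : (fun n : nat => G n%:R - approx_primitive beta n%:R -
    (G x - approx_primitive beta x)) @ \oo -->
    rotated_integral a 0 beta - 0 - (G x - approx_primitive beta x).
  apply: cvgB; last exact: cvg_cst.
  by apply: cvgB; [exact: cvg_integral_cos|exact: cvg_approx].
rewrite -/(G x) distrC.
have -> : rotated_integral a 0 beta + approx_primitive beta x - G x =
    rotated_integral a 0 beta - 0 - (G x - approx_primitive beta x) by ring.
apply: (cvgr_to_le (cvg_norm l)).
near=> n; apply: step; near: n; exact: nbhs_infty_ger.
Unshelve. all: by end_near. Qed.

Lemma osc_main_termE x : 0 < x -> osc_main_term kappa x =
  ((a^-1 * x `^ (- kappa^-1) * sin (x `^ a)) +i*
   (- (a^-1 * x `^ (- kappa^-1) * cos (x `^ a))))%C.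
Proof.
move=> x0; rewrite /osc_main_term oscE // -complexiE.
have y0 : x `^ kappa^-1 != 0 by rewrite gt_eqF ?powR_gt0.
have a0 : a != 0 by rewrite gt_eqF.
set y := a * x `^ kappa^-1.
have y1 : y != 0 by rewrite mulf_neq0.
have -> : a^-1 * x `^ (- kappa^-1) = y^-1 by rewrite powRN invfM.
have yi : ('i%C * y%:C%C)^-1 = (0 -i* y^-1)%C :> R[i].
  apply: mulr1_eq; apply/eqP; rewrite eq_complex /=.
  by apply/andP; split; apply/eqP; field.
by rewrite yi; apply/eqP; rewrite eq_complex /=; apply/andP; split; apply/eqP; ring.
Qed.

Lemma normc_osc_main_term x : 0 < x ->
  normc (osc_main_term kappa x) = a^-1 * x `^ (- kappa^-1).
Proof.
move=> x0; rewrite osc_main_termE//= sqrrN !exprMn -mulrDr [sin _ ^+ 2 + _]addrC cos2Dsin2 mulr1.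
by rewrite -exprMn sqrtr_sqr ger0_norm// mulr_ge0 ?powR_ge0// invr_ge0 ltW.
Qed.

Lemma primitive_osc_error x : 0 < x ->
  normc (primitive (osc kappa) x - (continuation a 0 + osc_main_term kappa x)) <=
    4 * k * x `^ (- 1 - 2 / kappa).
Proof.
move=> x0.
have kx := mulr_ge0 k_ge0 (powR_ge0 x (- 1 - 2 / kappa)).
have close beta :
    `|\int[mu]_(r in `]0, x]) cos (rpow r + beta) -
      (rotated_integral a 0 beta + a^-1 * x `^ (- kappa^-1) * sin (x `^ a + beta))|
     <= 2 * (k * x `^ (- 1 - 2 / kappa)).
  have h := primitive_expansion beta x0.
  have t1 : `|k * x `^ (- 1 - 2 / kappa) * cos (x `^ a + beta)| <=
      k * x `^ (- 1 - 2 / kappa).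
    by rewrite normrM (ger0_norm kx) ler_piMr ?cos_max.
  move: h t1; rewrite /approx_primitive !ler_norml => /andP[? ?] /andP[? ?].
  by apply/andP; split; lra.
have -> : 4 * k * x `^ (- 1 - 2 / kappa) = 2 * (2 * (k * x `^ (- 1 - 2 / kappa))) by ring.
rewrite primitiveE osc_main_termE //; apply: normc_le2; rewrite ?ReB ?ImB /=.
  by have := close 0; rewrite addr0; under eq_Rintegral do rewrite addr0.
have := close (- (pi / 2)); rewrite sinBpihalf mulrN.
by under eq_Rintegral do rewrite cosBpihalf.
Qed.

Lemma Linfty_osc : Linfty (osc kappa).
Proof.
have mp : measurable_fun setT (fun t : R => t `^ a) by exact: measurable_powR.
have mc (g : R -> R) : continuous g ->
    measurable_fun (`]0, +oo[%classic : set R) (fun t => g (t `^ a)).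
  move=> cg; apply: measurable_funTS; apply: measurableT_comp mp.
  exact: continuous_measurable_fun.
split.
- rewrite (_ : (fun t => _) = fun t => cos (t `^ a)); first exact: (mc _ (@continuous_cos R)).
  by apply/funext => t; rewrite oscE.
- rewrite (_ : (fun t => _) = fun t => sin (t `^ a)); first exact: (mc _ (@continuous_sin R)).
  by apply/funext => t; rewrite oscE.
apply: (@le_lt_trans _ _ 1%E); last exact: ltry.
apply: ess_sup_ler => t; rewrite patchE lee_fin; case: ifPn => // _.
by rewrite normc_osc.
Qed.

Lemma primitive_osc_bigO :
  (fun x => normc (primitive (osc kappa) x - (continuation a 0 + osc_main_term kappa x)))
    =O_pinfty (fun x => x `^ (- 1 - 2 / kappa)).
Proof.
apply/eqO_exP; exists (4 * k + 1).
  by rewrite ltr_wpDl// mulr_ge0// k_ge0.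
near=> x.
have x0 : 0 < x by near: x; exact: nbhs_pinfty_gt.
rewrite (ger0_norm (normc_ge0 _)) (ger0_norm (powR_ge0 _ _)).
apply: (le_trans (primitive_osc_error x0)).
by rewrite ler_wpM2r ?powR_ge0// lerDl.
Unshelve. all: by end_near. Qed.

(** The main term has modulus exactly x^(-1/kappa) / a, while the rest of the
    expansion is of order x^(-1/kappa) x^(-a). *)
Lemma primitive_osc_not_littleo :
  ~ (fun x => normc (primitive (osc kappa) x - continuation a 0))
      =o_pinfty (fun x => x `^ (- kappa^-1)).
Proof.
move=> /eqoP H.
have ai : 0 < a^-1 by rewrite invr_gt0.
have e0 : 0 < a^-1 / 4 by rewrite divr_gt0.
have k1 : 0 < 4 * k + 1 by rewrite ltr_wpDl// mulr_ge0// k_ge0.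
have [x [x0 xo xs]] : exists x, [/\ 0 < x,
    normc (primitive (osc kappa) x - continuation a 0) <= a^-1 / 4 * x `^ (- kappa^-1) &
    x `^ (- a) <= a^-1 / 4 / (4 * k + 1)].
  near (pinfty_nbhs R) => x; exists x; split.
  - by near: x; exact: nbhs_pinfty_gt.
  - have : `|normc (primitive (osc kappa) x - continuation a 0)| <=
        a^-1 / 4 * `|x `^ (- kappa^-1)| by near: x; exact: H.
    by rewrite (ger0_norm (normc_ge0 _)) (ger0_norm (powR_ge0 _ _)).
  - have : `|0 - x `^ (- a)| <= a^-1 / 4 / (4 * k + 1).
      near: x; move: (cvg_powRN a_gt0) => /cvgrPdist_le; apply.
      by rewrite divr_gt0.
    by rewrite sub0r normrN ger0_norm ?powR_ge0.
have X0 : 0 < x `^ (- kappa^-1) by exact: powR_gt0.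
have tri : normc (osc_main_term kappa x) <=
    normc (primitive (osc kappa) x - continuation a 0) +
    normc (primitive (osc kappa) x - (continuation a 0 + osc_main_term kappa x)).
  rewrite -[X in _ <= _ + X]normcN; apply: le_trans (le_normcD _ _).
  by rewrite le_eqVlt; apply/orP; left; apply/eqP; congr normc; ring.
have err := primitive_osc_error x0.
have XE : x `^ (- 1 - 2 / kappa) = x `^ (- kappa^-1) * x `^ (- a).
  rewrite -powRD ?(gt_eqF x0) ?implybT//; congr (_ `^ _); ring.
have : 4 * k * x `^ (- 1 - 2 / kappa) <= x `^ (- kappa^-1) * (a^-1 / 4).
  rewrite XE mulrCA ler_pM2l//.
  apply: (@le_trans _ _ ((4 * k + 1) * x `^ (- a))).
    by rewrite ler_wpM2r ?powR_ge0// lerDl.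
  by rewrite mulrC -ler_pdivlMr.
have aX : 0 < a^-1 * x `^ (- kappa^-1) by rewrite mulr_gt0.
have -> : x `^ (- kappa^-1) * (a^-1 / 4) = a^-1 * x `^ (- kappa^-1) / 4 by ring.
move: tri err xo aX; rewrite normc_osc_main_term//.
have -> : a^-1 / 4 * x `^ (- kappa^-1) = a^-1 * x `^ (- kappa^-1) / 4 by ring.
lra.
Unshelve. all: by end_near. Qed.

End Asymptotics.

(** * The oscillating example *)

Theorem mainTheorem7 (R : realType) (kappa C : R) (kappa_gt0 : 0 < kappa)
    (C_gt0 : 0 < C) :
  [/\ Linfty (osc kappa),
      exists F : R[i] -> R[i],
        [/\ laplace_continuation (Omega kappa C) (osc kappa) F,
            polynomial_growth (Omega kappa C) F &
            (fun x : R => normc (primitive (osc kappa) x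
                           - (F 0 + osc_main_term kappa x)))
              =O_pinfty (fun x : R => x `^ (- 1 - 2 / kappa))] &
      optimal_error (Omega kappa C) (fun x : R => x `^ (- kappa^-1))].
Proof.
have a_gt1 : 1 < 1 + kappa^-1 by rewrite ltrDl invr_gt0.
have contF : laplace_continuation (Omega kappa C) (osc kappa) (continuation (1 + kappa^-1)).
  split; last by move=> s; exact: continuation_laplace.
  exists setT => //; split; first exact: openT.
  by move=> s _; exact: continuation_derivable.
have growthF := continuation_growth kappa_gt0 C_gt0.
split; first exact: Linfty_osc.
  exists (continuation (1 + kappa^-1)); split => //; exact: primitive_osc_bigO.
move=> taub; apply: (primitive_osc_not_littleo kappa_gt0).
exact: taub (Linfty_osc kappa) contF growthF.
Qed.
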